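(* Let $\alpha\in(0,2)$, $\rho\in(0,1]$ and $\theta>0$. Let $B^{\theta}_{\alpha,\rho}=\{B^{\theta}_{\alpha,\rho}(t),t\ge0\}$ be the tempered $\Gamma$-grey Brownian motion, i.e. the process whose finite-dimensional distributions are given, for $n\in\mathbb{N}$, $0\le t_1\le\dots\le t_n<\infty$ and $\xi_1,\dots,\xi_n\in\mathbb{R}$, by $$\mathbb{E}\,e^{i\sum_{k=1}^n\xi_kB^{\theta}_{\alpha,\rho}(t_k)}=\frac{\Gamma\left(\rho,\theta+\frac12\sum_{j,k=1}^n\xi_j\xi_k\gamma_\alpha(t_j,t_k)\right)}{\Gamma(\rho,\theta)},\qquad \gamma_\alpha(s,t)=t^\alpha+s^\alpha-|t-s|^\alpha.$$ Then the following equality of all finite-dimensional distributions holds: $$\{B^{\theta}_{\alpha,\rho}(t)\}_{t\ge0}\overset{f.d.d.}{=}\{\sqrt{Y^{\rho}_{\theta}}\,B^{\alpha/2}(t)\}_{t\ge0},$$ where $B^{\alpha/2}$ is a fractional Brownian motion with Hurst parameter $H=\alpha/2$, and $Y^\rho_\theta$ is a random variable, independent of $B^{\alpha/2}$, with density $$l^{\theta}_{\rho}(y)=\frac{1}{\Gamma(\rho,\theta)\Gamma(1-\rho)}\,\frac{e^{-\theta y}}{y(y-1)^{\rho}}\,1_{y>1},\qquad \rho\in(0,1),$$ and $Y^1_\theta=1$ almost surely when $\rho=1$.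
   Context: $\Gamma(\rho,x):=\int_x^{+\infty}e^{-w}w^{\rho-1}\,dw$ is the upper incomplete gamma function. The fractional Brownian motion $B^{\alpha/2}=\{B^{\alpha/2}(t),t\ge0\}$ with Hurst parameter $\alpha/2$ is normalized as the centered Gaussian process with covariance $\mathbb{E}[B^{\alpha/2}(t)B^{\alpha/2}(s)]=\gamma_\alpha(s,t)=t^\alpha+s^\alpha-|t-s|^\alpha$, $s,t\ge0$. *)

(* Defs.v *)
From HB Require Import structures.
From mathcomp Require Import all_boot all_order all_algebra.
From mathcomp Require Import complex.
From mathcomp Require Import all_classical all_reals all_analysis.
From mathcomp Require Import measurable_realfun.

Set Implicit Arguments.
Unset Strict Implicit.
Unset Printing Implicit Defensive.

Import Order.TTheory GRing.Theory Num.Theory.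
Import numFieldNormedType.Exports.

Local Open Scope classical_set_scope.
Local Open Scope ring_scope.

(* The complete Gamma function is [upper_gamma rho 0]. *)
Definition upper_gamma {R : realType} (rho x : R) : R :=
  \int[@lebesgue_measure R]_(w in `]x, +oo[) (expR (- w) * w `^ (rho - 1)).

Definition gamma_cov {R : realType} (alpha s t : R) : R :=
  t `^ alpha + s `^ alpha - `|t - s| `^ alpha.

(* Real-valued stochastic processes with time set [0, +oo[. *)
Definition process {d : measure_display} {T : measurableType d} {R : realType}
    (P : probability T R) : Type :=
  {nonneg R} -> {RV P >-> R}.

(* E[e^{iX}] for a real random variable X, via Euler's formula. *)
Definition expect_expi {d : measure_display} {T : measurableType d}
    {R : realType} (P : probability T R) (X : T -> R) : R[i] :=
  Complex (\int[P]_w cos (X w)) (\int[P]_w sin (X w)).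

Definition fdd {d : measure_display} {T : measurableType d} {R : realType}
    {P : probability T R} (X : process P) (n : nat) (t : 'I_n -> {nonneg R})
    (w : T) : n.-tuple R :=
  [tuple X (t i) w | i < n].

Lemma measurable_fdd {d : measure_display} {T : measurableType d}
    {R : realType} {P : probability T R} (X : process P) (n : nat)
    (t : 'I_n -> {nonneg R}) : measurable_fun setT (fdd X t).
Proof.
apply/measurable_fun_tnthP => i.
rewrite (_ : _ \o _ = X (t i)); first exact: measurable_funP.
by apply/funext => w /=; rewrite tnth_mktuple.
Qed.

HB.instance Definition _ {d : measure_display} {T : measurableType d}
    {R : realType} {P : probability T R} (X : process P) (n : nat)
    (t : 'I_n -> {nonneg R}) :=
  isMeasurableFun.Build _ _ _ _ (fdd X t) (measurable_fdd X t).

(* The two processes may live on different probability spaces. *)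
Definition fdd_eq {d1 d2 : measure_display} {T1 : measurableType d1}
    {T2 : measurableType d2} {R : realType} {P1 : probability T1 R}
    {P2 : probability T2 R} (X1 : process P1) (X2 : process P2) : Prop :=
  forall (n : nat) (t : 'I_n -> {nonneg R}) (A : set (n.-tuple R)),
    measurable A ->
    distribution P1 (fdd X1 t) A = distribution P2 (fdd X2 t) A.

Definition tempered_ggbm {d : measure_display} {T : measurableType d}
    {R : realType} {P : probability T R} (alpha rho theta : R)
    (X : process P) : Prop :=
  forall (n : nat) (t : 'I_n -> {nonneg R}) (xi : 'I_n -> R),
    (forall j k : 'I_n, (j <= k)%N -> (t j)%:num <= (t k)%:num) ->
    expect_expi P (fun w => \sum_(k < n) xi k * X (t k) w) =
    (upper_gamma rho
       (theta + 2^-1 * \sum_(j < n) \sum_(k < n)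
          xi j * xi k * gamma_cov alpha (t j)%:num (t k)%:num)
     / upper_gamma rho theta)%:C%C.

(* [normal_prob m 0] is a uniform law in the library, so the degenerate case is
   treated separately. *)
Definition gaussian_law {R : realType} (m s : R) (A : set R) : \bar R :=
  if s == 0 then \d_m A else normal_prob m s A.

Definition gaussian_rv {d : measure_display} {T : measurableType d}
    {R : realType} (P : probability T R) (X : T -> R) : Prop :=
  exists m s : R, 0 <= s /\
    forall A : set R, measurable A -> P (X @^-1` A) = gaussian_law m s A.

Definition gaussian_process {d : measure_display} {T : measurableType d}
    {R : realType} {P : probability T R} (X : process P) : Prop :=
  forall (n : nat) (t : 'I_n -> {nonneg R}) (c : 'I_n -> R),
    gaussian_rv P (fun w => \sum_(k < n) c k * X (t k) w).

(* Normalized so that B(t) has variance 2 t^(2H). *)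
Definition fractional_brownian_motion {d : measure_display}
    {T : measurableType d} {R : realType} {P : probability T R} (H : R)
    (B : process P) : Prop :=
  [/\ gaussian_process B,
      forall t : {nonneg R}, ('E_P[B t] = 0)%E &
      forall s t : {nonneg R},
        ('E_P[B t \* B s] = (gamma_cov (2 * H) s%:num t%:num)%:E)%E].

Definition sigma_process {d : measure_display} {T : measurableType d}
    {R : realType} {P : probability T R} (X : process P) : set (set T) :=
  <<s \bigcup_(t : {nonneg R}) preimage_set_system setT (X t) measurable >>.

Definition independent_rv_process {d : measure_display} {T : measurableType d}
    {R : realType} {P : probability T R} (Y : {RV P >-> R}) (X : process P)
    : Prop :=
  forall E F : set T,
    preimage_set_system setT Y measurable E -> sigma_process X F ->
    P (E `&` F) = (P E * P F)%E.

Definition mixing_density {R : realType} (rho theta y : R) : R :=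
  (upper_gamma rho theta * upper_gamma (1 - rho) 0)^-1
  * (expR (- theta * y) / (y * (y - 1) `^ rho)) * \1_[set z : R | 1 < z] y.

Definition mixing_rv {d : measure_display} {T : measurableType d}
    {R : realType} {P : probability T R} (rho theta : R) (Y : {RV P >-> R})
    : Prop :=
  (rho < 1 -> forall A : set R, measurable A ->
     distribution P Y A =
     (\int[lebesgue_measure]_(y in A) (mixing_density rho theta y)%:E)%E) /\
  (rho = 1 -> {ae P, forall w, Y w = 1}).

Definition sqrt_scaled_fun {d : measure_display} {T : measurableType d}
    {R : realType} {P : probability T R} (Y : {RV P >-> R}) (X : process P)
    (t : {nonneg R}) (w : T) : R :=
  Num.sqrt (Y w) * X t w.

Lemma measurable_sqrt_scaled_fun {d : measure_display} {T : measurableType d}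
    {R : realType} {P : probability T R} (Y : {RV P >-> R}) (X : process P)
    (t : {nonneg R}) : measurable_fun setT (sqrt_scaled_fun Y X t).
Proof.
apply: measurable_funM; last exact: measurable_funP.
apply: (measurableT_comp (f := @Num.sqrt R)); last exact: measurable_funP.
by apply: continuous_measurable_fun; exact: sqrt_continuous.
Qed.

HB.instance Definition _ {d : measure_display} {T : measurableType d}
    {R : realType} {P : probability T R} (Y : {RV P >-> R}) (X : process P)
    (t : {nonneg R}) :=
  isMeasurableFun.Build _ _ _ _ (sqrt_scaled_fun Y X t)
    (measurable_sqrt_scaled_fun Y X t).

Definition sqrt_scaled {d : measure_display} {T : measurableType d}
    {R : realType} {P : probability T R} (Y : {RV P >-> R}) (X : process P)
    : process P :=
  fun t => sqrt_scaled_fun Y X t.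

(* Main.v *)
Require Import Defs.
From HB Require Import structures.
From mathcomp Require Import all_boot all_order all_algebra all_fingroup.
From mathcomp Require Import complex.
From mathcomp Require Import all_classical all_reals all_analysis.
From mathcomp Require Import measurable_realfun.
From mathcomp Require Import ring lra.

(* Both families of finite-dimensional laws have the same characteristic
   function. Given Y, the combination sqrt(Y) * sum_k xi_k B(t_k) is centered
   Gaussian with variance Y * v, where v = sum_jk xi_j xi_k gamma(t_j, t_k), so
   by independence its characteristic function is the Laplace transform of Y at
   v / 2. Writing w^(rho - 1) as a Laplace transform and exchanging the
   integrals gives
     Gamma(rho, x) Gamma(1 - rho) = \int_1^oo e^(- x y) / (y (y - 1)^rho) dy,
   which for x = theta + v / 2 is the prescribed value. The finiteness of the
   Gamma integrals comes for free: otherwise the density of Y would vanish.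

   Characteristic functions determine laws on R^n because the smallest class of
   functions containing the plane waves cos(<xi, x> + c) and stable under linear
   combinations and bounded pointwise limits is an algebra, hence contains
   sgn(sin((x_i - a) / m)), whose limit as m -> oo is sgn(x_i - a), hence all
   indicators of Borel sets. The Gaussian characteristic function solves an ODE
   obtained by differentiating under the integral and integrating by parts. *)

Set Implicit Arguments.
Unset Strict Implicit.
Unset Printing Implicit Defensive.

Import Order.TTheory GRing.Theory Num.Theory.
Import numFieldNormedType.Exports.
Local Open Scope classical_set_scope.
Local Open Scope ring_scope.

(** * Functions determined by their characteristic function *)

Lemma bounded_integrable {R : realType} {d} {T : measurableType d}
    (P : probability T R) (f : T -> R) (M : R) :
  measurable_fun setT f -> (forall x, `|f x| <= M) ->
  P.-integrable setT (EFin \o f).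
Proof.
move=> mf fM; apply: measurable_bounded_integrable => //.
- exact: le_lt_trans (probability_le1 P measurableT) (ltry 1).
- exists M; split; first exact: num_real.
  by move=> y My x _ /=; rewrite (le_trans (fM x))// ltW.
Qed.

Lemma probability_integral_cst {R : realType} {d} {T : measurableType d}
    (P : probability T R) (r : R) : (\int[P]_w r%:E = r%:E)%E.
Proof.
rewrite integral_cst// [X in (_ * X)%E](_ : _ = 1%E) ?mule1//.
exact: (probability_setT P).
Qed.

(** The bound [M] in the limit rule is shared by the whole sequence, so that a constant dominates it
    and integrals against probability measures pass to the limit. *)
Inductive bounded_closure {R : realType} {T : Type} (G : set (T -> R)) :
    (T -> R) -> Prop :=
| bounded_closure_base f : G f -> bounded_closure G f
| bounded_closure_lin (a b : R) f g :
    bounded_closure G f -> bounded_closure G g ->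
    bounded_closure G (fun x => a * f x + b * g x)
| bounded_closure_lim (f_ : nat -> T -> R) f (M : R) :
    (forall n, bounded_closure G (f_ n)) ->
    (forall n x, `|f_ n x| <= M) ->
    (forall x, f_ n x @[n --> \oo] --> f x) ->
    bounded_closure G f.

Lemma cvg_norm_le {R : realType} (u : nat -> R) (l M : R) :
  (forall n, `|u n| <= M) -> u n @[n --> \oo] --> l -> `|l| <= M.
Proof.
move=> uM ul; have cl : `|u n| @[n --> \oo] --> `|l| by exact: cvg_norm.
rewrite -(cvg_lim (@Rhausdorff R) cl); apply: limr_le; first exact: cvgP cl.
exact: nearW.
Qed.

(** * Products and set operations in the closure *)

Section bounded_closure_theory.
Context {R : realType} {T : Type} {G : set (T -> R)}.
Hypothesis G_bounded : forall f, G f -> exists M : R, forall x, `|f x| <= M.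
Hypothesis G_mul : forall f g, G f -> G g ->
  bounded_closure G (fun x => f x * g x).

Local Notation cl := (bounded_closure G).

Lemma bounded_closure_bounded f : cl f -> exists M : R, forall x, `|f x| <= M.
Proof.
elim=> {f} [f /G_bounded//|a b f g _ [M fM] _ [N gN]|f_ f M _ _ f_M f_f].
- exists (`|a| * M + `|b| * N) => x.
  by rewrite (le_trans (ler_normD _ _))// !normrM lerD// ler_wpM2l.
- by exists M => x; apply: cvg_norm_le (f_f x) => n; exact: f_M.
Qed.

(** Two nested inductions: first on [g] with [f] a generator, then on [f] for all [g]. Boundedness
    of the other factor keeps the product sequences uniformly bounded in the limit rule. *)
Lemma bounded_closure_mul f g : cl f -> cl g -> cl (fun x => f x * g x).
Proof.
move=> cf; elim: cf g => {f} [f Gf|a b f1 f2 _ IH1 _ IH2|f_ f M cf_ IH fM ff] g cg.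
- have [Mf fMf] := G_bounded Gf.
  elim: cg => {g} [g Gg|a b g1 g2 _ IH1 _ IH2|g_ g M _ IH gM gg].
  + exact: G_mul.
  + have -> : (fun x => f x * (a * g1 x + b * g2 x)) =
              (fun x => a * (f x * g1 x) + b * (f x * g2 x)).
      by apply/funext => x; ring.
    exact: bounded_closure_lin.
  + apply: (@bounded_closure_lim _ _ _ (fun n x => f x * g_ n x) _ (Mf * M)) => //.
    * by move=> n x; rewrite normrM ler_pM.
    * by move=> x; apply: cvgM; [exact: cvg_cst|exact: gg].
- have -> : (fun x => (a * f1 x + b * f2 x) * g x) =
            (fun x => a * (f1 x * g x) + b * (f2 x * g x)).
    by apply/funext => x; ring.
  by apply: bounded_closure_lin; [exact: IH1|exact: IH2].
- have [N gN] := bounded_closure_bounded cg.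
  apply: (@bounded_closure_lim _ _ _ (fun n x => f_ n x * g x) _ (M * N)).
  + by move=> n; exact: IH.
  + by move=> n x; rewrite normrM ler_pM.
  + by move=> x; apply: cvgM; [exact: ff|exact: cvg_cst].
Qed.

Hypothesis cl1 : cl (cst 1).

Lemma bounded_closureC A : cl \1_A -> cl \1_(~` A).
Proof.
move=> cA.
have -> : \1_(~` A) = (fun x => 1 * cst 1 x + -1 * \1_A x) :> (T -> R).
  apply/funext => x; rewrite !indicE in_setC /=.
  by case: (x \in A) => /=; ring.
exact: bounded_closure_lin.
Qed.

Lemma bounded_closureU A B : cl \1_A -> cl \1_B -> cl \1_(A `|` B).
Proof.
move=> cA cB; rewrite -[A `|` B]setCK; apply: bounded_closureC.
rewrite setCU.
have -> : \1_(~` A `&` ~` B) = (fun x => \1_(~` A) x * \1_(~` B) x) :> (T -> R).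
  by apply/funext => x; rewrite indicI.
by apply: bounded_closure_mul; exact: bounded_closureC.
Qed.

Lemma bounded_closure_bigcup (F : nat -> set T) :
  (forall n, cl \1_(F n)) -> cl \1_(\bigcup_n F n).
Proof.
move=> cF.
apply: (@bounded_closure_lim _ _ _ (fun n => \1_(\big[setU/set0]_(i < n) F i)) _ 1).
- elim=> [|n IH]; last by rewrite big_ord_recr; exact: bounded_closureU.
  by rewrite big_ord0 -setCT; apply: bounded_closureC; rewrite indicT.
- by move=> n x; rewrite indicE; case: (_ \in _); rewrite ?normr1 ?normr0.
- move=> x; apply: cvg_near_cst.
  have [[N _ FNx]|nF] := pselect ((\bigcup_n F n) x).
  + exists N.+1 => //= n /= Nn; rewrite !indicE; congr (_%:R); congr nat_of_bool.
    rewrite mem_set; first by rewrite mem_set//; exists N.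
    by rewrite -bigcup_mkord; exists N.
  + near=> n; rewrite !indicE; congr (_%:R); congr nat_of_bool.
    rewrite memNset; first by rewrite memNset.
    by rewrite -bigcup_mkord => -[i _ Fi]; apply: nF; exists i.
Unshelve. all: by end_near. Qed.

(** The map [h] allows two uses: the identity for measurable sets of tuples, and a coordinate for
    Borel sets of the line. *)
Lemma bounded_closure_preimage_sigma_algebra U (h : T -> U) :
  sigma_algebra setT [set B | cl \1_(h @^-1` B)].
Proof.
split => /=.
- by rewrite preimage_set0 -setCT; apply: bounded_closureC; rewrite indicT.
- by move=> A /=; rewrite setTD -preimage_setC; exact: bounded_closureC.
- by move=> F cF; rewrite preimage_bigcup; exact: bounded_closure_bigcup.
Qed.

End bounded_closure_theory.

Section bounded_closure_integral.
Context {R : realType} {d} {T : measurableType d} {G : set (T -> R)}.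
Hypothesis G_bounded : forall f, G f -> exists M : R, forall x, `|f x| <= M.
Hypothesis G_measurable : forall f, G f -> measurable_fun setT f.

Local Notation cl := (bounded_closure G).

Lemma bounded_closure_measurable f : cl f -> measurable_fun setT f.
Proof.
elim=> {f} [f /G_measurable//|a b f g _ mf _ mg|f_ f M _ mf_ _ ff].
- by apply: measurable_funD; apply: measurable_funM.
- by apply: (measurable_fun_cvg (h := f_)) => // x _; exact: ff.
Qed.

(** Integration is linear on bounded measurable functions and respects bounded limits by dominated
    convergence, so agreement on [G] spreads to the closure. *)
Lemma bounded_closure_integral (P Q : probability T R) :
  (forall f, G f -> (\int[P]_x (f x)%:E = \int[Q]_x (f x)%:E)%E) ->
  forall f, cl f -> (\int[P]_x (f x)%:E = \int[Q]_x (f x)%:E)%E.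
Proof.
move=> PQ f; elim=> {f} [f /PQ//|a b f g cf fE cg gE|f_ f M cf_ fE fM ff].
- have step (P' : probability T R) :
      (\int[P']_x (a * f x + b * g x)%:E =
       a%:E * \int[P']_x (f x)%:E + b%:E * \int[P']_x (g x)%:E)%E.
    have [Mf fMf] := bounded_closure_bounded G_bounded cf.
    have [Mg gMg] := bounded_closure_bounded G_bounded cg.
    have mf := bounded_closure_measurable cf.
    have mg := bounded_closure_measurable cg.
    under eq_integral do rewrite EFinD !EFinM.
    have If := bounded_integrable P' mf fMf.
    have Ig := bounded_integrable P' mg gMg.
    by rewrite integralD ?integralZl//; exact: integrableZl.
  by rewrite !step fE gE.
- have lim (P' : probability T R) :
      (\int[P']_x (f_ n x)%:E @[n --> \oo] --> \int[P']_x (f x)%:E)%E.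
    have mf_ n := bounded_closure_measurable (cf_ n).
    apply: (@dominated_cvg _ _ _ P' setT measurableT
      (fun n x => (f_ n x)%:E) _ (cst M%:E)) => //.
    + by move=> n; exact/measurable_EFinP.
    + by move=> x _; apply: cvg_EFin; [exact: nearW|exact: ff].
    + by apply: (@bounded_integrable _ _ _ P' (cst M) `|M|).
    + by move=> n x _; rewrite lee_fin.
  have limQ := lim Q.
  rewrite (_ : (fun n => _) = (fun n => \int[P]_x (f_ n x)%:E)%E) in limQ.
    exact: cvg_unique (lim P) limQ.
  by apply/funext => n; rewrite fE.
Qed.

End bounded_closure_integral.

(** * Approximation of the sign by iterated polynomials *)

Section sign_iterates.
Context {R : realType}.
Implicit Type s : R.

(* A cubic map of [-1, 1] into itself whose iterates converge to the sign. *)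
Definition sharpen s : R := 2^-1 * (3 * s - s * s * s).

Lemma sharpenN s : sharpen (- s) = - sharpen s.
Proof. by rewrite /sharpen; ring. Qed.

Lemma sharpen_norm_le1 s : `|s| <= 1 -> `|sharpen s| <= 1.
Proof.
rewrite !ler_norml => /andP[s1 s2].
(* The points 1 and -1 are fixed and critical for [sharpen], so the gaps to these values have double
   roots there and factors of visible sign. *)
have E1 : 1 - sharpen s = (1 - s) ^+ 2 * (2 + s) / 2 by rewrite /sharpen; field.
have E2 : 1 + sharpen s = (1 + s) ^+ 2 * (2 - s) / 2 by rewrite /sharpen; field.
have h1 : 0 <= 1 - sharpen s by rewrite E1 !mulr_ge0 ?sqr_ge0//; lra.
have h2 : 0 <= 1 + sharpen s by rewrite E2 !mulr_ge0 ?sqr_ge0//; lra.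
by apply/andP; split; lra.
Qed.

Lemma iter_sharpen_norm_le1 (n : nat) s :
  `|s| <= 1 -> `|iter n sharpen s| <= 1.
Proof. by move=> s1; elim: n => //= n IH; exact: sharpen_norm_le1. Qed.

Lemma iter_sharpenN n s : iter n sharpen (- s) = - iter n sharpen s.
Proof. by elim: n => //= n ->; rewrite sharpenN. Qed.

(** Each step multiplies the gap to 1 by [(1 - u) * (2 + u) / 2 = 1 - u / 2 - u ^+ 2 / 2], which is
    at most [1 - s / 2] because the iterates [u] never fall below [s]. Convergence is therefore
    geometric. *)
Lemma iter_sharpen_ge n s : 0 < s <= 1 ->
  (s <= iter n sharpen s <= 1) && (1 - iter n sharpen s <= (1 - s / 2) ^+ n).
Proof.
move=> /andP[s0 s1]; elim: n => [|n /andP[/andP[sn n1] IH]].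
  by rewrite /= lexx s1/= expr0; lra.
rewrite iterS exprS; move: sn n1 IH; set u := iter n sharpen s.
set q := (1 - s / 2) ^+ n => su u1 uq.
have E : 1 - sharpen u = (1 - u) * ((1 - u) * (2 + u) / 2).
  by rewrite /sharpen; field.
have h : (1 - u) * (2 + u) / 2 <= 1 - s / 2 by nra.
have h0 : 0 <= (1 - u) * (2 + u) / 2 by nra.
have E' : sharpen u - u = u * (1 - u) * (1 + u) / 2.
  by rewrite /sharpen; field.
have i1 : 0 <= sharpen u - u.
  by rewrite E' !mulr_ge0//; lra.
have i2 : 0 <= 1 - sharpen u by rewrite E mulr_ge0//; lra.
have i3 : 1 - sharpen u <= (1 - s / 2) * q.
  by rewrite E mulrC ler_pM//; lra.
by rewrite i3 andbT; apply/andP; split; lra.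
Qed.

Lemma cvg_iter_sharpen s : `|s| <= 1 ->
  iter n sharpen s @[n --> \oo] --> Num.sg s.
Proof.
have pos (t : R) : 0 < t <= 1 -> iter n sharpen t @[n --> \oo] --> (1 : R).
  move=> t01; have /andP[t0 t1] := t01.
  have q0 : (1 - t / 2) ^+ n @[n --> \oo] --> (0 : R).
    have : `|1 - t / 2| < 1 by rewrite ger0_norm; lra.
    exact: cvg_expr.
  apply: (@squeeze_cvgr _ _ _ _ (fun n => 1 - (1 - t / 2) ^+ n) (cst 1)).
  - apply: nearW => n; have /andP[/andP[_ h1] h2] := iter_sharpen_ge n t01.
    by rewrite /= h1 andbT lerBlDl addrC -lerBlDl.
  - by rewrite -[X in _ --> X]subr0; apply: cvgB => //; exact: cvg_cst.
  - exact: cvg_cst.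
move=> s1; case: (ltrgtP s 0) => [s0|s0|->].
- rewrite ltr0_sg// -[s]opprK; under eq_fun do rewrite iter_sharpenN.
  apply: cvgN; apply: pos; rewrite oppr_gt0 s0/=.
  by rewrite (le_trans _ s1)// -normrN ler_norm.
- by rewrite gtr0_sg//; apply: pos; rewrite s0 (le_trans _ s1)// ler_norm.
- rewrite sgr0 (_ : (fun _ => _) = cst 0); first exact: cvg_cst.
  by apply/funext; elim=> //= n ->; rewrite /sharpen /=; ring.
Qed.

End sign_iterates.

(** * Plane waves on R^n and measurable sets *)

Section trigonometric_closure.
Context {R : realType} {n : nat}.
Local Notation T := (n.-tuple R).
Implicit Type x : T.

(** The phase [c] makes sines available as shifted cosines. *)
Definition plane_wave : set (T -> R) := [set f |
  exists (xi : 'I_n -> R) (c : R),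
    f = fun x => cos (\sum_(k < n) xi k * tnth x k + c)].

Local Notation cl := (bounded_closure plane_wave).

Lemma plane_wave_bounded f : plane_wave f -> exists M : R, forall x, `|f x| <= M.
Proof. by move=> [xi [c ->]]; exists 1 => x; exact: cos_max. Qed.

Lemma plane_wave_measurable f : plane_wave f -> measurable_fun setT f.
Proof.
move=> [xi [c ->]].
apply: (measurableT_comp (f := @cos R)).
  by apply: continuous_measurable_fun; exact: continuous_cos.
apply: measurable_funD => //; apply: measurable_sum => k.
by apply: measurable_funM => //; exact: measurable_tnth.
Qed.

(** Product-to-sum formula for cosines: frequencies and phases are added and subtracted. *)
Lemma plane_wave_mul f g : plane_wave f -> plane_wave g ->
  cl (fun x => f x * g x).
Proof.
move=> [xi [c ->]] [eta [e ->]].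
pose w1 x := cos (\sum_(k < n) (xi k + eta k) * tnth x k + (c + e)).
pose w2 x := cos (\sum_(k < n) (xi k - eta k) * tnth x k + (c - e)).
have -> : (fun x => cos (\sum_(k < n) xi k * tnth x k + c) *
                    cos (\sum_(k < n) eta k * tnth x k + e)) =
          (fun x => 2^-1 * w1 x + 2^-1 * w2 x).
  apply/funext => x; rewrite /w1 /w2.
  under [in RHS]eq_bigr do rewrite mulrDl.
  under [X in _ = _ + _ * cos (X + _)]eq_bigr do rewrite mulrBl.
  rewrite big_split/= sumrB.
  set a := \sum_k _; set b := \sum_k _.
  have -> : a + b + (c + e) = (a + c) + (b + e) by ring.
  have -> : a - b + (c - e) = (a + c) - (b + e) by ring.
  by move: (a + c) (b + e) => u v; rewrite cosD cosB; field.
by apply: bounded_closure_lin; apply: bounded_closure_base;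
  [exists (fun k => xi k + eta k), (c + e)|exists (fun k => xi k - eta k), (c - e)].
Qed.

Let clM := bounded_closure_mul plane_wave_bounded plane_wave_mul.

Lemma bounded_closure1 : cl (cst 1).
Proof.
apply: bounded_closure_base; exists (fun=> 0), 0; apply/funext => x.
by rewrite big1 ?addr0 ?cos0// => i _; rewrite mul0r.
Qed.

(** The iterates of [sharpen] are polynomials in [f], hence in the algebra, and stay bounded by
    1. *)
Lemma bounded_closure_sg f : (forall x, `|f x| <= 1) -> cl f ->
  cl (fun x => Num.sg (f x)).
Proof.
move=> f1 cf.
apply: (@bounded_closure_lim _ _ _ (fun m x => iter m sharpen (f x)) _ 1).
- elim=> [//|m IH].
  have -> : (fun x => iter m.+1 sharpen (f x)) =
      (fun x => 3 / 2 * iter m sharpen (f x) + - 2^-1 *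
       (iter m sharpen (f x) * iter m sharpen (f x) * iter m sharpen (f x))).
    by apply/funext => x; rewrite iterS /sharpen; ring.
  apply: bounded_closure_lin => //.
  by apply: (clM (f := fun x => _ * _)) => //; exact: clM.
- by move=> m x; exact: iter_sharpen_norm_le1.
- by move=> x; exact: cvg_iter_sharpen.
Qed.

Lemma bounded_closure_ray (i : 'I_n) (a : R) :
  cl \1_((fun x : T => tnth x i) @^-1` `]a, +oo[%classic).
Proof.
pose s x := Num.sg (tnth x i - a).
have cs : cl s.
  apply: (@bounded_closure_lim _ _ _
    (fun m x => Num.sg (sin (m.+1%:R^-1 * (tnth x i - a)))) _ 1).
  - move=> m; apply: bounded_closure_sg => [x|]; first exact: sin_max.
    apply: bounded_closure_base.
    (* The phase [- pi / 2] turns the cosine into a sine, and [- (a / m.+1%:R)] centers it at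
       [a]. *)
    exists (fun k => (k == i)%:R / m.+1%:R), (- (a / m.+1%:R) - pi / 2).
    apply/funext => x; rewrite addrA cosBpihalf; congr sin.
    rewrite (bigD1 i)//= eqxx mul1r big1 ?addr0; first by rewrite mulrBr mulrC [X in _ - X]mulrC.
    by move=> j /negPf ->; rewrite !mul0r.
  - by move=> m x; rewrite normr_sg; case: eqP.
  - move=> x; apply: cvg_near_cst; near=> m.
    rewrite /s; set y := tnth x i - a.
    (* From here on the argument of the sine lies in (-1, 1), where sine has the sign of its
       argument. *)
    have ym : `|y| < m.+1%:R.
      near: m; have := nbhs_infty_ger `|y|; apply: filterS => m /le_lt_trans; apply.
      by rewrite ltr_nat.
    have m0 : 0 < m.+1%:R :> R by rewrite ltr0n.
    have pos (z : R) : 0 < z -> z < m.+1%:R -> 0 < sin (m.+1%:R^-1 * z).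
      move=> z0 zm; apply: sin2_gt0; rewrite mulr_gt0 ?invr_gt0//=.
      by rewrite mulrC ltr_pdivrMr//; lra.
    case: (ltrgtP y 0) => [y0|y0|->].
    + rewrite [RHS]ltr0_sg// ltr0_sg// -oppr_gt0 -sinN -mulrN.
      by apply: pos; [rewrite oppr_gt0|rewrite (le_lt_trans _ ym)// -normrN ler_norm].
    + rewrite [RHS]gtr0_sg// gtr0_sg//; apply: pos => //.
      by rewrite (le_lt_trans _ ym)// ler_norm.
    + by rewrite mulr0 sin0.
(* The polynomial [(s ^ 2 + s) / 2] sends 1 to 1 and both 0 and -1 to 0, which gives the ray open at
   [a]. *)
have -> : \1_((fun x : T => tnth x i) @^-1` `]a, +oo[%classic) =
    (fun x => 2^-1 * (s x * s x) + 2^-1 * s x) :> (T -> R).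
  apply/funext => x; rewrite indicE /s.
  have [xa|ax] := ltP a (tnth x i).
    by rewrite mem_set/= ?in_itv/= ?andbT// gtr0_sg ?subr_gt0//; field.
  rewrite memNset/=; last by rewrite in_itv/= andbT ltNge ax.
  case: (ltrgtP (tnth x i) a) ax => // [xa _|-> _].
    by rewrite ltr0_sg ?subr_lt0//; field.
  by rewrite subrr sgr0; ring.
by apply: bounded_closure_lin => //; exact: clM.
Unshelve. all: by end_near. Qed.

(** Two generation steps: coordinate preimages of Borel sets generate the measurable sets of tuples,
    and open rays generate the Borel sets. *)
Lemma bounded_closure_indic (A : set T) : measurable A -> cl \1_A.
Proof.
have salg U (h : T -> U) := bounded_closure_preimage_sigma_algebra
  plane_wave_bounded plane_wave_mul bounded_closure1 h.
move: A; apply: smallest_sub; first exact: salg T id.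
elim/big_ind: _ => [//|X Y XD YD|i _]; first by rewrite subUset.
move=> _ [B mB <-] /=; rewrite setTI.
move: mB; rewrite [measurable B](_ : _ = (@RGenOInfty.G R).-sigma.-measurable B).
  move: B; apply: smallest_sub; first exact: (salg _ (fun x => tnth x i)).
  by move=> _ [a ->]; exact: bounded_closure_ray.
by rewrite -RGenOInfty.measurableE.
Qed.

End trigonometric_closure.

Lemma plane_wave_unique {R : realType} {n : nat} (P Q : probability (n.-tuple R) R) :
  (forall f, plane_wave f -> (\int[P]_x (f x)%:E = \int[Q]_x (f x)%:E)%E) ->
  forall A, measurable A -> P A = Q A.
Proof.
move=> PQ A mA; have := bounded_closure_integral plane_wave_bounded
  plane_wave_measurable PQ (bounded_closure_indic mA).
by rewrite !integral_indic// setIT.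
Qed.

(** * Densities and Gaussian integrals *)

Section density.
Context {R : realType} {d} {T : measurableType d}.
Variables (nu : probability T R) (mu : {sigma_finite_measure set T -> \bar R}).
Variable g : T -> R.
Hypothesis g_ge0 : forall x, 0 <= g x.
Hypothesis mg : measurable_fun setT g.
Hypothesis nuE :
  forall A, measurable A -> nu A = (\int[mu]_(x in A) (g x)%:E)%E.

Let dom : nu `<< mu.
Proof.
apply/null_content_dominatesP => A mA muA0; rewrite nuE//.
by apply: null_set_integral => //; exact/measurable_funTS/measurable_EFinP.
Qed.

(** The density [g] agrees almost everywhere with the Radon-Nikodym derivative of [nu], since both
    have integral [nu A] over every measurable [A]. *)
Lemma ge0_integral_density (f : T -> \bar R) :
  measurable_fun setT f -> (forall x, 0 <= f x)%E ->
  (\int[nu]_x f x = \int[mu]_x (f x * (g x)%:E))%E.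
Proof.
move=> mf f0.
rewrite -(Radon_Nikodym_SigmaFinite.change_of_variables dom)//.
have If := Radon_Nikodym_SigmaFinite.f_integrable dom.
apply: ae_eq_integral => //.
- by apply: emeasurable_funM => //; exact: measurable_int If.
- by apply: emeasurable_funM => //; exact/measurable_EFinP.
- apply: ae_eqe_mul2l; apply: integral_ae_eq => //; first exact/measurable_EFinP.
  move=> E _ mE; transitivity (nu E); last exact: nuE.
  exact/esym/Radon_Nikodym_SigmaFinite.f_integral.
Qed.

Lemma integrable_density (f : T -> R) : measurable_fun setT f ->
  mu.-integrable setT (fun x => (f x * g x)%:E) ->
  nu.-integrable setT (EFin \o f).
Proof.
move=> mf /integrableP[_ fg]; apply/integrableP; split.
  exact/measurable_EFinP.
rewrite ge0_integral_density//.
  apply: le_lt_trans fg; rewrite le_eqVlt; apply/orP; left; apply/eqP.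
  by apply: eq_integral => x _ /=; rewrite -EFinM normrM (ger0_norm (g_ge0 x)).
by apply: measurableT_comp => //; exact/measurable_EFinP.
Qed.

Lemma Rintegral_density (f : T -> R) : measurable_fun setT f ->
  mu.-integrable setT (fun x => (f x * g x)%:E) ->
  \int[nu]_x f x = \int[mu]_x (f x * g x).
Proof.
move=> mf fg; rewrite /Rintegral; congr fine.
have mEf : measurable_fun setT (EFin \o f) by exact/measurable_EFinP.
(* Multiplication by the nonnegative [g] commutes with taking positive and negative parts, so the
   nonnegative case applies to each. *)
rewrite [LHS]integralE [RHS]integralE; congr (_ - _)%E.
- rewrite ge0_integral_density//; last exact: measurable_funepos.
  apply: eq_integral => x _; rewrite !funeposE -!EFin_max -EFinM.
  by rewrite maxr_pMl// mul0r.
- rewrite ge0_integral_density//; last exact: measurable_funeneg.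
  apply: eq_integral => x _; rewrite !funenegE -!EFinN -!EFin_max -EFinM.
  by rewrite maxr_pMl// mul0r mulNr.
Qed.

End density.

(** * Domination of quadratic growth by a wider normal density *)

Section normal_moments.
Context {R : realType}.
Variables (m s : R).
Hypothesis s0 : s != 0.
Local Notation mu := (@lebesgue_measure R).
Local Notation p := (normal_pdf m s).
Local Notation s2 := (Num.sqrt 2 * s).

Let s2_neq0 : s2 != 0.
Proof. by rewrite mulf_neq0// gt_eqF// sqrtr_gt0. Qed.

(** Split the exponent into two equal halves [y]: one factor [expR (- y)] is the Gaussian of
    deviation [s2], the other absorbs the quadratic term through [y * expR (- y) <= 1]. *)
Lemma normal_fun_decay (x : R) : (1 + (x - m) ^+ 2) * normal_fun m s x <=
  (1 + 4 * s ^+ 2) * normal_fun m s2 x.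
Proof.
pose y := (x - m) ^+ 2 / (4 * s ^+ 2).
have s20 : 0 < s ^+ 2 by rewrite exprn_even_gt0.
have y0 : 0 <= y by rewrite divr_ge0 ?sqr_ge0// mulr_ge0// ltW.
have -> : normal_fun m s x = expR (- y) * expR (- y).
  by rewrite -expRD; congr expR; rewrite /y; field; rewrite s0.
have -> : normal_fun m s2 x = expR (- y).
  rewrite /normal_fun exprMn sqr_sqrtr//; congr expR.
  by rewrite /y; field; rewrite s0.
have -> : (x - m) ^+ 2 = 4 * s ^+ 2 * y by rewrite /y; field; rewrite s0.
rewrite mulrA; apply: ler_wpM2r; first exact: expR_ge0.
have e1 : expR (- y) <= 1 by rewrite expR_le1 oppr_le0.
have e2 : y * expR (- y) <= 1.
  rewrite expRN ler_pdivrMr ?expR_gt0// mul1r.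
  by rewrite (le_trans _ (expR_ge1Dx y))// lerDr.
rewrite mulrDl mul1r lerD// -mulrA ler_piMr// mulr_ge0//; exact: ltW.
Qed.

(** Corrects for the different normalizing constants of the deviations [s] and [s2]. *)
Let ratio := normal_peak s / normal_peak s2.

Lemma normal_pdf_decay (f : R -> R) (C x : R) :
  `|f x| <= C * (1 + (x - m) ^+ 2) ->
  `|f x * p x| <= C * (1 + 4 * s ^+ 2) * ratio * normal_pdf m s2 x.
Proof.
move=> fC; rewrite normrM (ger0_norm (normal_pdf_ge0 m s x)).
have C0 : 0 <= C.
  have h : 0 < 1 + (x - m) ^+ 2 by rewrite ltr_pwDl// sqr_ge0.
  by rewrite -(pmulr_lge0 _ h) (le_trans _ fC).
rewrite (le_trans (ler_wpM2r (normal_pdf_ge0 m s x) fC))//.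
rewrite !normal_pdfE// /ratio.
rewrite [leRHS](_ : _ = C * (normal_peak s *
   ((1 + 4 * s ^+ 2) * normal_fun m s2 x))); last first.
  by field; rewrite gt_eqF// normal_peak_gt0.
rewrite -[leLHS]mulrA; apply: ler_wpM2l => //; rewrite mulrCA.
apply: ler_wpM2l; first exact: normal_peak_ge0.
exact: normal_fun_decay.
Qed.

Lemma integrable_normal_pdfM (f : R -> R) (C : R) : measurable_fun setT f ->
  (forall x, `|f x| <= C * (1 + (x - m) ^+ 2)) ->
  mu.-integrable setT (fun x => (f x * p x)%:E).
Proof.
move=> mf fC.
apply: (@le_integrable _ _ _ mu setT measurableT _ (fun x =>
    (C * (1 + 4 * s ^+ 2) * ratio)%:E * (normal_pdf m s2 x)%:E)%E).
- by apply/measurable_EFinP/measurable_funM => //; exact: measurable_normal_pdf.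
- move=> x _ /=; rewrite lee_fin.
  by rewrite (le_trans (normal_pdf_decay (fC x)))// ler_norm.
- by apply: integrableZl => //; exact: integrable_normal_pdf.
Qed.

End normal_moments.

(** * Decay of the normal density at infinity *)

Section normal_vanish.
Context {R : realType}.
Implicit Types m s : R.

Lemma cvg_normal_pdfy m s : s != 0 -> normal_pdf m s x @[x --> +oo] --> (0 : R).
Proof.
move=> s0; rewrite normal_pdfE//.
rewrite -[X in _ --> X](mulr0 (normal_peak s)).
apply: cvgM; first exact: cvg_cst.
have c0 : 0 < (Num.sqrt (s ^+ 2 *+ 2))^-1.
  by rewrite invr_gt0 sqrtr_gt0 pmulrn_lgt0// exprn_even_gt0.
rewrite (_ : normal_fun m s =
    gauss_fun \o (fun x => (x - m) / Num.sqrt (s ^+ 2 *+ 2))); last first.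
  apply/funext => x; rewrite /= /normal_fun /gauss_fun; congr expR.
  rewrite expr_div_n sqr_sqrtr; first by rewrite mulNr.
  by rewrite mulrn_wge0// sqr_ge0.
apply: (cvg_comp _ _ _ cvg_gauss_fun).
by apply: gt0_cvgMly => //; exact: cvg_addrr.
Qed.

Lemma normal_pdfN m s (x : R) : s != 0 ->
  normal_pdf m s (- x) = normal_pdf (- m) s x.
Proof.
have E : - x - m = - (x - - m) by ring.
by move=> s0; rewrite !normal_pdfE// /normal_fun E sqrrN.
Qed.

(** These are the boundary terms of an integration by parts. Reflecting the density reduces the left
    end to the right end. *)
Lemma cvg_normal_pdfM m s (f : R -> R) (C : R) : s != 0 ->
  (forall x, `|f x| <= C * (1 + (x - m) ^+ 2)) ->
  (f n%:R * normal_pdf m s n%:R @[n --> \oo] --> (0 : R)) /\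
  (f (- n%:R) * normal_pdf m s (- n%:R) @[n --> \oo] --> (0 : R)).
Proof.
move=> s0 fC.
have r0 : Num.sqrt 2 * s != 0 by rewrite mulf_neq0// gt_eqF// sqrtr_gt0.
pose K := C * (1 + 4 * s ^+ 2) * (normal_peak s / normal_peak (Num.sqrt 2 * s)).
have cvg0 (m' : R) :
    K * normal_pdf m' (Num.sqrt 2 * s) n%:R @[n --> \oo] --> (0 : R).
  rewrite -[X in _ --> X](mulr0 K); apply: cvgM; first exact: cvg_cst.
  exact: (cvg_comp _ _ cvgr_idn (cvg_normal_pdfy m' r0)).
split; apply: norm_cvg0.
- apply: (squeeze_cvgr _ (cvg_cst 0) (cvg0 m)).
  by apply: nearW => n; rewrite normr_ge0/=; exact: normal_pdf_decay.
- apply: (squeeze_cvgr _ (cvg_cst 0) (cvg0 (- m))).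
  apply: nearW => n; rewrite normr_ge0/= -normal_pdfN//.
  exact: normal_pdf_decay.
Qed.

End normal_vanish.

(** * Fundamental theorem of calculus on the whole line *)

Section improper_ftc.
Context {R : realType}.
Local Notation mu := (@lebesgue_measure R).

(** On a symmetric interval the integral is the difference of the end values of [F]; dominated
    convergence with bound [|f|] passes to the line. *)
Lemma Rintegral_derivative_eq0 (F f : R -> R) :
  (forall x : R, is_derive x 1 F (f x)) -> continuous f ->
  mu.-integrable setT (EFin \o f) ->
  F n%:R @[n --> \oo] --> (0 : R) -> F (- n%:R) @[n --> \oo] --> (0 : R) ->
  \int[mu]_x f x = 0.
Proof.
move=> dF cf If Fy FNy.
have cF : continuous F.
  by move=> x; apply/differentiable_continuous/derivable1_diffP; have [] := dF x.
pose I n := `[- n%:R, n%:R]%classic : set R.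
(* The index is [n.+1] because the theorem on an interval needs distinct endpoints. *)
have fi n : (\int[mu]_x ((f \_ (I n.+1)) x)%:E =
    (F n.+1%:R - F (- n.+1%:R))%:E)%E.
  rewrite EFinB -(@continuous_FTC2 _ f F).
  - by rewrite [RHS]integral_mkcond restrict_EFin.
  - by rewrite gtrN// ltr0n.
  - exact: continuous_subspaceT.
  - split.
    + by move=> x _; have [] := dF x.
    + exact/cvg_at_right_filter/cF.
    + exact/cvg_at_left_filter/cF.
  - by move=> x _; rewrite derive1E; have [_ ->] := dF x.
have mf : measurable_fun setT f by exact: continuous_measurable_fun.
have cvg1 : (\int[mu]_x ((f \_ (I n.+1)) x)%:E @[n --> \oo] -->
    \int[mu]_x (f x)%:E)%E.
  apply: (@dominated_cvg _ _ _ mu setT measurableT _ _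
    (fun x => `|(f x)%:E|%E)) => //.
  - move=> n; apply/measurable_EFinP.
    by apply/(measurable_restrictT _ _).1; [exact: measurable_itv|exact: measurable_funTS].
  - move=> x _; apply: cvg_near_cst; near=> n.
    rewrite patchE mem_set// /I /= in_itv/= -ler_norml.
    near: n; have := nbhs_infty_ger `|x|; apply: filterS => n /le_trans; apply.
    by rewrite ler_nat.
  - exact: integrable_abse.
  - by move=> n x _; rewrite patchE; case: ifPn => //=; rewrite normr0 lee_fin.
have cvg2 : ((F n.+1%:R - F (- n.+1%:R))%:E @[n --> \oo] --> (0 : R)%:E)%E.
  apply: cvg_EFin; first exact: nearW.
  rewrite -[X in _ --> X](subr0 0); apply: cvgB.
    by rewrite -(cvg_shiftS (fun n => F n%:R)) in Fy.
  by rewrite -(cvg_shiftS (fun n => F (- n%:R))) in FNy.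
rewrite /Rintegral (_ : (\int[mu]_x (f x)%:E)%E = 0%:E)//.
rewrite (_ : (fun n => _) = (fun n => (F n.+1%:R - F (- n.+1%:R))%:E)) in cvg1.
  exact: cvg_unique cvg1 cvg2.
by apply/funext => n; exact: fi.
Unshelve. all: by end_near. Qed.

End improper_ftc.

(** * Integration by parts against the normal density *)

Section stein.
Context {R : realType}.
Variables (m s : R).
Hypothesis s0 : s != 0.
Local Notation mu := (@lebesgue_measure R).
Local Notation p := (normal_pdf m s).

Lemma is_derive_normal_pdf (x : R) :
  is_derive x 1 p (- ((x - m) / s ^+ 2) * p x).
Proof.
rewrite normal_pdfE//.
have -> : (fun x => normal_peak s * normal_fun m s x) =
   (fun x => normal_peak s * expR (- (2^-1 / s ^+ 2) * ((x - m) * (x - m)))).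
  apply/funext => y; rewrite /normal_fun; congr (_ * expR _).
  by field; rewrite s0.
pose q (y : R) := - (2^-1 / s ^+ 2) * ((y - m) * (y - m)).
have dq : is_derive x 1 q (- ((x - m) / s ^+ 2)).
  by apply: is_derive_eq; rewrite /GRing.scale/=; field; rewrite s0.
have de := is_derive1_comp (is_derive_expR (q x)) dq.
have -> : normal_fun m s x = expR (q x).
  by rewrite /normal_fun /q; congr expR; field; rewrite s0.
apply: (@is_derive_eq _ _ _ (fun y => normal_peak s * (expR \o q) y)).
by rewrite /GRing.scale/=; ring.
Qed.

(** The product [f p] is a primitive of [f' p - (x - m) f p / s ^ 2], because
    [p' = - (x - m) p / s ^ 2]. The bound on [f] kills the boundary terms; the other two give
    integrability. *)
Lemma stein (f f' : R -> R) (C : R) : (forall x : R, is_derive x 1 f (f' x)) ->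
  continuous f' ->
  (forall x, `|f x| <= C * (1 + (x - m) ^+ 2)) ->
  (forall x, `|f' x| <= C * (1 + (x - m) ^+ 2)) ->
  (forall x, `|(x - m) * f x| <= C * (1 + (x - m) ^+ 2)) ->
  \int[mu]_x (f' x * p x) = (s ^+ 2)^-1 * \int[mu]_x ((x - m) * f x * p x).
Proof.
move=> df cf' bf bf' bxf.
have cf : continuous f.
  by move=> x; apply/differentiable_continuous/derivable1_diffP; have [] := df x.
have mf : measurable_fun setT f by exact: continuous_measurable_fun.
have mf' : measurable_fun setT f' by exact: continuous_measurable_fun.
have mxm : measurable_fun setT (fun x : R => x - m) by exact: measurable_funB.
have I1 := integrable_normal_pdfM s0 mf' bf'.
have I2 := integrable_normal_pdfM s0 (measurable_funM mxm mf) bxf.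
have cp : continuous p by exact: continuous_normal_pdf.
pose h x := f' x * p x - (s ^+ 2)^-1 * ((x - m) * f x * p x).
have : \int[mu]_x h x = 0.
  have [Fy FNy] := cvg_normal_pdfM s0 bf.
  apply: (@Rintegral_derivative_eq0 _ (fun x => f x * p x)) => //.
  - move=> x; have dfx := df x; have dpx := is_derive_normal_pdf x.
    apply: is_derive_eq; rewrite /h /GRing.scale/=; field; by rewrite s0.
  - move=> x; apply: cvgB; first by apply: cvgM; [exact: cf'|exact: cp].
    apply: cvgM; first exact: cvg_cst.
    apply: cvgM; last exact: cp.
    apply: cvgM; last exact: cf.
    by apply: cvgB; [exact: cvg_id|exact: cvg_cst].
  - have -> : EFin \o h = (fun x => (f' x * p x)%:E -
        ((s ^+ 2)^-1)%:E * ((x - m) * f x * p x)%:E)%E by [].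
    by apply: integrableB => //; exact: integrableZl.
rewrite /h RintegralB; [|by []|exact: I1|exact: integrableZl I2].
by rewrite RintegralZl// => /eqP; rewrite subr_eq0 => /eqP.
Qed.

End stein.

Section normal_integrals.
Context {R : realType}.
Variables (m s : R).
Hypothesis s0 : s != 0.
Local Notation mu := (@lebesgue_measure R).
Local Notation p := (normal_pdf m s).

Let le1D (z : R) : 1 <= 1 * (1 + z ^+ 2).
Proof. by rewrite mul1r lerDl sqr_ge0. Qed.

Let normD (z : R) : `|z| <= 1 * (1 + z ^+ 2).
Proof. by rewrite -(real_normK (num_real z)); have := normr_ge0 z; nra. Qed.

Let sqrD (z : R) : `|z * z| <= 1 * (1 + z ^+ 2).
Proof. by rewrite -expr2 normrX real_normK ?num_real// mul1r lerDr. Qed.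

Let mxm : measurable_fun setT (fun x : R => x - m).
Proof. exact: measurable_funB. Qed.

Lemma integrable_normal_center :
  mu.-integrable setT (fun x => ((x - m) * p x)%:E).
Proof. by apply: (integrable_normal_pdfM s0 mxm (C := 1)) => x; exact: normD. Qed.

Lemma integrable_normal_center_sqr :
  mu.-integrable setT (fun x => ((x - m) ^+ 2 * p x)%:E).
Proof.
apply: (integrable_normal_pdfM s0 _ (C := 1)).
  exact: measurable_funX.
by move=> x; rewrite expr2; exact: sqrD.
Qed.

(** Apply [stein] to the constant function 1. *)
Lemma normal_center_mean : \int[mu]_x ((x - m) * p x) = 0.
Proof.
have d1 (x : R) : is_derive x 1 (cst 1 : R -> R) (cst 0 x) by exact: is_derive_cst.
have c0 : continuous (cst 0 : R -> R) by move=> x; exact: cvg_cst.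
have b1 x : `|cst (1 : R) x| <= 1 * (1 + (x - m) ^+ 2) by rewrite normr1.
have b0 x : `|cst (0 : R) x| <= 1 * (1 + (x - m) ^+ 2).
  by rewrite normr0 (le_trans _ (le1D _)).
have bx x : `|(x - m) * cst 1 x| <= 1 * (1 + (x - m) ^+ 2) by rewrite mulr1.
have := stein s0 d1 c0 b1 b0 bx.
rewrite (_ : \int[mu]_x (cst 0 x * p x) = 0); last first.
  by rewrite /Rintegral integral0_eq// => x _ /=; rewrite mul0r.
under [in X in _ = _ * X -> _]eq_Rintegral do rewrite /= mulr1.
by move/esym/eqP; rewrite mulf_eq0 invr_eq0 sqrf_eq0 (negPf s0) => /eqP.
Qed.

(** Apply [stein] to [x - m], whose derivative integrates to the total mass 1. *)
Lemma normal_variance : \int[mu]_x ((x - m) ^+ 2 * p x) = s ^+ 2.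
Proof.
have d1 (x : R) : is_derive x 1 (fun x => x - m) (cst 1 x).
  by apply: is_derive_eq; rewrite subr0.
have c1 : continuous (cst 1 : R -> R) by move=> x; exact: cvg_cst.
have b1 x : `|cst (1 : R) x| <= 1 * (1 + (x - m) ^+ 2) by rewrite normr1.
have := stein s0 d1 c1 (fun x => normD (x - m)) b1 (fun x => sqrD (x - m)).
rewrite (_ : \int[mu]_x (cst 1 x * p x) = 1); last first.
  under eq_Rintegral do rewrite mul1r.
  by rewrite /Rintegral integral_normal_pdf.
under [in X in _ = _ * X -> _]eq_Rintegral do rewrite -expr2.
move=> h; apply: (mulfI (x := (s ^+ 2)^-1)); first by rewrite invr_eq0 sqrf_eq0.
by rewrite -h mulVf// sqrf_eq0.
Qed.

End normal_integrals.

(** * Characteristic function of the centered normal law *)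

Section normal_characteristic.
Context {R : realType}.
Variable s : R.
Hypothesis s0 : s != 0.
Local Notation mu := (@lebesgue_measure R).
Local Notation p := (normal_pdf 0 s).

Let ccos : continuous (@cos R). Proof. exact: continuous_cos. Qed.
Let csin : continuous (@sin R). Proof. exact: continuous_sin. Qed.

Let clin (u c : R) : continuous (fun x : R => u * x + c).
Proof.
move=> x; apply: cvgD; last exact: cvg_cst.
by apply: cvgM; [exact: cvg_cst|exact: cvg_id].
Qed.

Let ccoslin (u c : R) : continuous (fun x : R => cos (u * x + c)).
Proof. by move=> x; apply: continuous_comp; [exact: clin|exact: ccos]. Qed.

Let csinlin (u c : R) : continuous (fun x : R => sin (u * x + c)).
Proof. by move=> x; apply: continuous_comp; [exact: clin|exact: csin]. Qed.

Let one_le (x : R) : 1 <= 1 + (x - 0) ^+ 2.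
Proof. by rewrite lerDl sqr_ge0. Qed.

Let norm_le (x : R) : `|x| <= 1 + (x - 0) ^+ 2.
Proof. by rewrite subr0 -(real_normK (num_real x)); have := normr_ge0 x; nra. Qed.

Lemma integrable_normal_cos (u c : R) :
  mu.-integrable setT (fun x => (cos (u * x + c) * p x)%:E).
Proof.
apply: (integrable_normal_pdfM s0 _ (C := 1)).
  exact: continuous_measurable_fun.
by move=> x; rewrite mul1r (le_trans (cos_max _)).
Qed.

Let Phi (c u : R) := \int[mu]_x (cos (u * x + c) * p x).

(** Differentiating under the integral produces [- x sin (u x + c)]; [stein] applied to
    [sin (u x + c)] trades the factor [x] for [u * s ^+ 2] and turns the sine back into a cosine. *)
Let is_derive_Phi (c u : R) : is_derive u 1 (Phi c) (- (u * s ^+ 2) * Phi c u).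
Proof.
pose f (v x : R) := cos (v * x + c) * p x.
have df (v x : R) : is_derive v 1 (f ^~ x) (- (x * sin (v * x + c)) * p x).
  have dl : is_derive v 1 (fun v : R => v * x + c) x.
    by apply: is_derive_eq; rewrite /GRing.scale/=; ring.
  have dc := is_derive1_comp (x := v) (g := fun v => v * x + c) (is_derive_cos _) dl.
  apply: (@is_derive_eq _ _ _ (fun v : R => (cos \o (fun v : R => v * x + c)) v * p x)).
  by rewrite /GRing.scale/=; ring.
(* This bounds the partial derivative for all [v] at once, so the neighbourhood []u - 1, u + 1[] is
   an arbitrary choice. *)
pose G (x : R) := `|x| * p x.
have Iu : `]u - 1, u + 1[%classic u by rewrite /= in_itv/=; lra.
have intf v : `]u - 1, u + 1[%classic v -> mu.-integrable setT (EFin \o f v).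
  by move=> _; exact: integrable_normal_cos.
have derf v x : `]u - 1, u + 1[%classic v -> setT x -> derivable (f ^~ x) v 1.
  by move=> _ _; have [] := df v x.
have G0 x : 0 <= G x by rewrite mulr_ge0// normal_pdf_ge0.
have intG : mu.-integrable setT (EFin \o G).
  apply: (integrable_normal_pdfM s0 _ (C := 1)).
    exact: normr_measurable.
  by move=> x; rewrite mul1r normr_id.
have p1 v x : partial1of2 f v x = - (x * sin (v * x + c)) * p x.
  by rewrite partial1of2E; have [_ ->] := df v x.
have fG v x : `]u - 1, u + 1[%classic v -> setT x -> `|partial1of2 f v x| <= G x.
  move=> _ _; rewrite p1 mulNr normrN !normrM (ger0_norm (normal_pdf_ge0 _ _ _)).
  by rewrite ler_wpM2r ?normal_pdf_ge0// ler_piMr// sin_max.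
have D := derivable_under_integral measurableT Iu intf derf G0 intG fG.
have E := differentiation_under_integral measurableT Iu intf derf G0 intG fG.
apply: DeriveDef => //; rewrite -derive1E E.
have dsin (x : R) : is_derive x 1 (fun x : R => sin (u * x + c)) (u * cos (u * x + c)).
  have dl : is_derive x 1 (fun x : R => u * x + c) u.
    by apply: is_derive_eq; rewrite /GRing.scale/=; ring.
  apply: (is_derive_eq (is_derive1_comp (x := x) (g := fun x => u * x + c) (is_derive_sin _) dl)).
  by rewrite mulrC.
have cc : continuous (fun x : R => u * cos (u * x + c)).
  by move=> x; apply: cvgM; [exact: cvg_cst|exact: ccoslin].
have leC (x y : R) : `|x| <= 1 + (y - 0) ^+ 2 ->
    `|x| <= (1 + `|u|) * (1 + (y - 0) ^+ 2).
  move=> h; rewrite (le_trans h)// ler_peMl ?lerDl//.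
  by rewrite (le_trans _ (one_le _)).
have b1 x : `|sin (u * x + c)| <= (1 + `|u|) * (1 + (x - 0) ^+ 2).
  by apply: leC; rewrite (le_trans (sin_max _)).
have b2 x : `|u * cos (u * x + c)| <= (1 + `|u|) * (1 + (x - 0) ^+ 2).
  rewrite normrM ler_pM//; first by rewrite lerDr.
  by rewrite (le_trans (cos_max _)).
have b3 x : `|(x - 0) * sin (u * x + c)| <= (1 + `|u|) * (1 + (x - 0) ^+ 2).
  apply: leC; rewrite normrM (le_trans _ (norm_le x))// subr0.
  by rewrite ler_piMr// sin_max.
have st := stein s0 dsin cc b1 b2 b3.
have Isin : mu.-integrable setT
    (fun x => ((x - 0) * sin (u * x + c) * p x)%:E).
  apply: (integrable_normal_pdfM s0 _ b3); apply: measurable_funM.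
    exact: measurable_funB.
  exact: continuous_measurable_fun.
rewrite (@eq_Rintegral _ _ _ mu _ (fun x => - 1 * ((x - 0) * sin (u * x + c) * p x))); last first.
  by move=> x _; rewrite p1 subr0; ring.
rewrite RintegralZl//.
move: st; under eq_Rintegral do rewrite -mulrA.
rewrite RintegralZl//; last exact: integrable_normal_cos.
rewrite -/(Phi c u) => /(congr1 (fun z => s ^+ 2 * z)).
rewrite [in RHS]mulrA mulfV ?sqrf_eq0// mul1r => <-; ring.
Qed.

(** Multiplying [Phi] by the inverse Gaussian factor gives a function of zero derivative, whose
    value at 0 is [cos c]. *)
Lemma normal_cos (u c : R) :
  \int[mu]_x (cos (u * x + c) * p x) = cos c * expR (- (u ^+ 2 * s ^+ 2 / 2)).
Proof.
pose h v := Phi c v * expR (v ^+ 2 * s ^+ 2 / 2).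
have dh (v : R) : is_derive v 1 h 0.
  have dP := is_derive_Phi c v.
  have dq : is_derive v 1 (fun v : R => v ^+ 2 * s ^+ 2 / 2) (v * s ^+ 2).
    by apply: is_derive_eq; rewrite /GRing.scale/=; field.
  have de := is_derive1_comp (x := v) (g := fun v => v ^+ 2 * s ^+ 2 / 2)
    (is_derive_expR _) dq.
  apply: (@is_derive_eq _ _ _ (fun v => Phi c v * (expR \o (fun v => v ^+ 2 * s ^+ 2 / 2)) v)).
  by rewrite /GRing.scale/=; ring.
have := is_derive_0_is_cst u 0 dh.
rewrite /h expr0n/= !mul0r expR0 mulr1 {2}/Phi.
under eq_Rintegral do rewrite mul0r add0r.
rewrite RintegralZl//; last exact: integrable_normal_pdf.
rewrite [X in _ = _ * X]/Rintegral integral_normal_pdf/= mulr1 => E.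
by rewrite -/(Phi c u) expRN -E mulfK// gt_eqF// expR_gt0.
Qed.

End normal_characteristic.

(** * Integrals of random variables through their laws *)

Section distribution_integral.
Context {R : realType} {d} {T : measurableType d} {d'} {T' : measurableType d'}.
Variables (P : probability T R) (X : {mfun T >-> T'}).

Lemma integrable_distribution (h : T' -> R) : measurable_fun setT h ->
  (distribution P X).-integrable setT (EFin \o h) ->
  P.-integrable setT (EFin \o (h \o X)).
Proof.
move=> mh /integrableP[_ hoo]; apply/integrableP; split.
  by apply/measurable_EFinP; exact: measurableT_comp.
move: hoo; rewrite ge0_integral_distribution//.
by apply: measurableT_comp => //; exact/measurable_EFinP.
Qed.

Lemma Rintegral_distribution (h : T' -> R) : measurable_fun setT h ->
  P.-integrable setT (EFin \o (h \o X)) ->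
  \int[distribution P X]_y h y = \int[P]_x h (X x).
Proof.
move=> mh Ih; rewrite /Rintegral (integral_distribution (f := EFin \o h))//.
exact/measurable_EFinP.
Qed.

End distribution_integral.

(* [R] and [measurableTypeR R], the carrier of the Lebesgue measure, have the
   same measurable sets but different displays. *)
Section pdf.
Context {R : realType} {d} {T : measurableType d}.
Variables (P : probability T R) (X : {mfun T >-> R}) (g : R -> R).
Hypothesis g_ge0 : forall x, 0 <= g x.
Hypothesis mg : measurable_fun setT g.
Hypothesis PXE : forall A : set R, measurable A ->
  P (X @^-1` A) = (\int[lebesgue_measure]_(x in A) (g x)%:E)%E.
Local Notation mu := (@lebesgue_measure R).

Let X1 : T -> measurableTypeR R := X.

Let mX1 : measurable_fun setT X1.
Proof. exact: (measurable_funP X). Qed.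

HB.instance Definition _ := isMeasurableFun.Build _ _ _ _ X1 mX1.

Lemma ge0_integral_pdf (h : R -> \bar R) :
  measurable_fun setT h -> (forall x, 0 <= h x)%E ->
  (\int[P]_w h (X w) = \int[mu]_x (h x * (g x)%:E))%E.
Proof.
move=> mh h0.
rewrite -(ge0_integral_density (nu := distribution P X1) (mu := mu) mg PXE mh h0).
by rewrite ge0_integral_distribution.
Qed.

Lemma integrable_pdf (h : R -> R) : measurable_fun setT h ->
  mu.-integrable setT (fun x => (h x * g x)%:E) ->
  P.-integrable setT (fun w => (h (X w))%:E).
Proof.
move=> mh Ih; apply: (integrable_distribution (X := X1) mh).
exact: (integrable_density (nu := distribution P X1) (mu := mu) g_ge0 mg PXE mh Ih).
Qed.

Lemma Rintegral_pdf (h : R -> R) : measurable_fun setT h ->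
  mu.-integrable setT (fun x => (h x * g x)%:E) ->
  \int[P]_w h (X w) = \int[mu]_x (h x * g x).
Proof.
move=> mh Ih.
rewrite -(Rintegral_density (nu := distribution P X1) (mu := mu) g_ge0 mg PXE mh Ih).
by rewrite (Rintegral_distribution (X := X1))//; exact: integrable_pdf.
Qed.

End pdf.

(** * Gaussian random variables, including degenerate ones *)

Section gaussian_rv_integrals.
Context {R : realType} {d} {T : measurableType d}.
Variables (P : probability T R) (X : {mfun T >-> R}).

(** The parameters of the law are tied to moments: the mean is [m], and if [m = 0] the second moment
    is [s ^+ 2], so that both can be eliminated afterwards. The formulas also cover [s = 0], where
    the law is a point mass. *)
Lemma gaussian_rv_integrals : gaussian_rv P X ->
  P.-integrable setT (fun w => (X w ^+ 2)%:E) /\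
  exists m s : R, [/\ \int[P]_w X w = m,
    m = 0 -> \int[P]_w X w ^+ 2 = s ^+ 2 &
    m = 0 -> forall u c, \int[P]_w cos (u * X w + c) =
                         cos c * expR (- (u ^+ 2 * s ^+ 2 / 2))].
Proof.
move=> [m [s [_ lawX]]].
pose nu := distribution P X.
have trans (h : R -> R) : measurable_fun setT h ->
    nu.-integrable setT (EFin \o h) ->
    P.-integrable setT (fun w => (h (X w))%:E) /\
    \int[P]_w h (X w) = \int[nu]_x h x.
  move=> mh Ih; have Ih' := integrable_distribution mh Ih.
  by split => //; rewrite Rintegral_distribution.
have mid : measurable_fun setT (@id R) by exact: measurable_id.
have msq : measurable_fun setT (fun x : R => x ^+ 2) by exact: measurable_funX.
have mcos (u c : R) : measurable_fun setT (fun x : R => cos (u * x + c)).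
  apply: (measurableT_comp (f := @cos R)).
    by apply: continuous_measurable_fun; exact: continuous_cos.
  by apply: measurable_funD => //; exact: measurable_funM.
have [s0|s0] := eqVneq s 0.
- have nuE A : measurable A -> nu A = \d_m A.
    by move=> mA; rewrite /nu /distribution /pushforward lawX// /gaussian_law s0 eqxx.
  have dirac (h : R -> R) : measurable_fun setT h ->
      P.-integrable setT (fun w => (h (X w))%:E) /\ \int[P]_w h (X w) = h m.
    move=> mh; have mEh : measurable_fun setT (EFin \o h) by exact/measurable_EFinP.
    have [|I ->] := trans h mh.
    + apply/integrableP; split => //.
      rewrite (eq_measure_integral (\d_m))//=; last by move=> A mA _; exact: nuE.
      rewrite integral_dirac//; last first.
        by do 2 apply: measurableT_comp => //.
      by rewrite diracE mem_set// mul1e ltry.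
    + split => //; rewrite /Rintegral (eq_measure_integral (\d_m))//=.
        by rewrite integral_dirac// diracE mem_set// mul1e.
      by move=> A mA _; exact: nuE.
  split; first by have [] := dirac _ msq.
  exists m, s; split.
  + by have [] := dirac _ mid.
  + by move=> m0; have [_ ->] := dirac _ msq; rewrite m0 s0.
  + move=> m0 u c; have [_ ->] := dirac _ (mcos u c).
    by rewrite m0 s0 expr0n/= !mulr0 mul0r oppr0 expR0 mulr1 add0r.
- pose p := normal_pdf m s.
  have PXE (A : set R) : measurable A ->
      P (X @^-1` A) = (\int[lebesgue_measure]_(x in A) (p x)%:E)%E.
    by move=> mA; rewrite lawX// /gaussian_law (negPf s0).
  have dens (h : R -> R) : measurable_fun setT h ->
      lebesgue_measure.-integrable setT (fun x => (h x * p x)%:E) ->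
      P.-integrable setT (fun w => (h (X w))%:E) /\
      \int[P]_w h (X w) = \int[lebesgue_measure]_x (h x * p x).
    move=> mh Ih.
    have p0 := normal_pdf_ge0 m s; have mp := measurable_normal_pdf m s.
    by split; [exact: integrable_pdf p0 mp PXE _ mh Ih|exact: Rintegral_pdf].
  have mxm : measurable_fun setT (fun x : R => x - m) by exact: measurable_funB.
  have [I1 E1] := dens _ mxm (integrable_normal_center m s0).
  have [I2 E2] := dens _ (measurable_funX 2 mxm) (integrable_normal_center_sqr m s0).
  (* The normal moment bounds are centered at [m], so integrability of [X] is recovered from that of
     [X - m]. *)
  have I1' : P.-integrable setT (fun w => (X w)%:E).
    have -> : (fun w => (X w)%:E) = (fun w => (X w - m)%:E + m%:E)%E.
      by apply/funext => w; rewrite -EFinD subrK.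
    apply: integrableD => //; exact: finite_measure_integrable_cst.
  split.
    have -> : (fun w => (X w ^+ 2)%:E) = (fun w => ((X w - m) ^+ 2)%:E +
        ((2 * m)%:E * (X w)%:E - (m ^+ 2)%:E))%E.
      by apply/funext => w; rewrite -EFinM -EFinB -EFinD; congr EFin; ring.
    apply: integrableD => //; apply: integrableB => //.
      exact: integrableZl.
    exact: finite_measure_integrable_cst.
  exists m, s; split.
  + move: E1; rewrite normal_center_mean// RintegralB//; last first.
      exact: finite_measure_integrable_cst.
    rewrite Rintegral_cst// (_ : fine _ = 1) ?mulr1; last first.
      exact: (congr1 fine (probability_setT P)).
    move=> /eqP.
    by rewrite subr_eq0 => /eqP.
  + move=> m0; move: E2; rewrite normal_variance// => <-.
    by apply: eq_Rintegral => w _; rewrite m0 subr0.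
  + move=> m0 u c.
    have Ic : lebesgue_measure.-integrable setT (fun x => (cos (u * x + c) * p x)%:E).
      by rewrite /p m0; exact: integrable_normal_cos.
    have [_ ->] := dens _ (mcos u c) Ic.
    by rewrite /p m0 normal_cos.
Qed.

Lemma gaussian_rv_integrable_sqr : gaussian_rv P X ->
  P.-integrable setT (fun w => (X w ^+ 2)%:E).
Proof. by move=> /gaussian_rv_integrals[]. Qed.

Lemma gaussian_rv_cos (u c : R) : gaussian_rv P X -> \int[P]_w X w = 0 ->
  \int[P]_w cos (u * X w + c) =
  cos c * expR (- (u ^+ 2 / 2 * \int[P]_w X w ^+ 2)).
Proof.
move=> /gaussian_rv_integrals[_ [m [s [-> vE cE]]]] m0.
by rewrite cE// vE//; congr (_ * expR (- _)); ring.
Qed.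

End gaussian_rv_integrals.

(** * The mixing density *)

Section affine_change_of_variables.
Context {R : realType}.
Variables (a b : R).
Hypothesis a_gt0 : 0 < a.
Local Notation mu := (@lebesgue_measure R).

Let phi (x : measurableTypeR R) : measurableTypeR R := a * x + b.

Let mphi : measurable_fun setT phi.
Proof. by apply: measurable_funD => //; exact: measurable_funM. Qed.

Let a_nng : {nonneg R} := NngNum (ltW a_gt0).

(** Lebesgue measure is determined by its values on half-open intervals. The preimage of []c, d]]
    has length [(d - c) / a], and the scaling by [a] restores [d - c]. *)
Let nuE (A : set (measurableTypeR R)) : measurable A ->
  mu A = pushforward (mscale a_nng mu) phi A.
Proof.
move=> mA; apply: lebesgue_measure_unique => // _ [[c d] _ <-] /=.
rewrite /pushforward /mscale/=.
have -> : phi @^-1` `]c, d]%classic = `](c - b) / a, (d - b) / a]%classic.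
  apply/seteqP; split => x /=; rewrite !in_itv/= /phi.
    by rewrite ltr_pdivrMr// ler_pdivlMr// ltrBlDr lerBrDr mulrC.
  by rewrite ltr_pdivrMr// ler_pdivlMr// ltrBlDr lerBrDr mulrC.
rewrite !lebesgue_measure_itv/= !lte_fin ltr_pM2r ?invr_gt0// ltrD2r.
case: ifPn => _; last by rewrite mule0.
by rewrite -!EFinB -EFinM; congr EFin; field; rewrite gt_eqF.
Qed.

Lemma ge0_integral_affine (f : R -> \bar R) :
  measurable_fun setT f -> (forall x, 0 <= f x)%E ->
  (\int[mu]_x f x = a%:E * \int[mu]_x f (a * x + b)%R)%E.
Proof.
move=> mf f0; rewrite -[X in X%:E]/(a_nng%:num) -(ge0_integral_mscale mu measurableT a_nng)//.
  rewrite -[in RHS](preimage_setT phi) -[RHS](ge0_integral_pushforward mphi _ measurableT mf)//.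
  by apply: eq_measure_integral => A mA _; exact: nuE.
exact: (measurableT_comp mf mphi).
Qed.

End affine_change_of_variables.

Lemma integral_indicM {R : realType} {d} {T : measurableType d}
    (mu : {measure set T -> \bar R}) (D : set T) (f : T -> R) :
  (\int[mu]_(x in D) (f x)%:E = \int[mu]_x (\1_D x * f x)%:E)%E.
Proof.
rewrite integral_mkcond; apply: eq_integral => x _.
by rewrite patchE indicE; case: (x \in D); rewrite ?mul1r ?mul0r.
Qed.

(** * Gamma integrals as Laplace transforms *)

Section gamma_laplace.
Context {R : realType}.
Local Notation mu := (@lebesgue_measure R).

(** With extended-real values, Tonelli's theorem applies before finiteness is known. Its [fine] part
    [upper_gamma] is 0 if the integral is infinite. *)
Definition eupper_gamma (rho x : R) : \bar R :=
  (\int[mu]_(w in `]x, +oo[) (expR (- w) * w `^ (rho - 1))%:E)%E.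

Lemma upper_gammaE (rho x : R) : upper_gamma rho x = fine (eupper_gamma rho x).
Proof. by []. Qed.

Lemma measurable_expRM (k : R) : measurable_fun setT (fun x => expR (k * x)).
Proof. by apply: measurableT_comp => //; exact: measurable_funM. Qed.

Lemma integral_expRN_tail (k x : R) : 0 < k ->
  (\int[mu]_(w in `]x, +oo[) (expR (- (k * w)))%:E = (expR (- (k * x)) / k)%:E)%E.
Proof.
move=> k0.
have mf : measurable_fun setT (fun w => (expR (- (k * w)))%:E).
  apply/measurable_EFinP; under eq_fun do rewrite -mulNr.
  exact: measurable_expRM.
have dF (w : R) : is_derive w 1 (fun w : R => - (k^-1 * expR (- (k * w))))
    (expR (- (k * w))).
  have dl : is_derive w 1 (fun w : R => - (k * w)) (- k).
    by apply: is_derive_eq; rewrite /GRing.scale/=; ring.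
  have de := is_derive1_comp (x := w) (g := fun w => - (k * w))
    (is_derive_expR _) dl.
  apply: (@is_derive_eq _ _ _
    (fun w : R => - (k^-1 * (expR \o (fun w => - (k * w))) w))).
  by rewrite /GRing.scale/=; field; rewrite gt_eqF.
have cF : continuous (fun w : R => - (k^-1 * expR (- (k * w)))).
  by move=> w; apply/differentiable_continuous/derivable1_diffP; have [] := dF w.
have cf : continuous (fun w : R => expR (- (k * w))).
  move=> w; apply: continuous_comp; last exact: continuous_expR.
  apply: cvgN; apply: cvgM; [exact: cvg_cst|exact: cvg_id].
rewrite integral_itv_obnd_cbnd; last exact: measurable_funTS.
rewrite (@ge0_continuous_FTC2y _ _ (fun w => - (k^-1 * expR (- (k * w)))) _ 0)//.
- by rewrite sub0e EFinN oppeK mulrC.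
- exact: continuous_subspaceT.
- rewrite -oppr0 -[X in - X](mulr0 k^-1); apply: cvgN.
  apply: cvgM; first exact: cvg_cst.
  apply: (cvg_comp (fun w : R => k * w) (fun z => expR (- z)) _ (@cvgr_expR R)).
  exact: gt0_cvgMry.
- exact/cvg_at_right_filter/cF.
- by move=> w _; rewrite derive1E; have [_ ->] := dF w.
Qed.

(** Substitute [v = w * u] in the integral defining Gamma(1 - rho). *)
Lemma integral_expRN_powR (rho w : R) : 0 < w ->
  (\int[mu]_(u in `]0%R, +oo[) (expR (- (w * u)) * u `^ (- rho))%:E =
   (w `^ (rho - 1))%:E * eupper_gamma (1 - rho) 0)%E.
Proof.
move=> w0; rewrite /eupper_gamma (_ : 1 - rho - 1 = - rho); last by ring.
rewrite [LHS]integral_indicM [in RHS]integral_indicM.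
set f := fun v : R => (\1_(`]0%R, +oo[%classic : set R) v * (expR (- v) * v `^ (- rho)))%:E.
have mf : measurable_fun setT f.
  apply/measurable_EFinP; apply: measurable_funM => //.
  apply: measurable_funM; last exact: measurable_powR.
  by apply: measurableT_comp => //; exact: measurable_oppr.
have f0 v : (0 <= f v)%E by rewrite lee_fin !mulr_ge0 ?expR_ge0 ?powR_ge0.
rewrite (ge0_integral_affine 0 w0 mf f0) muleA.
rewrite -ge0_integralZl_EFin//; last 2 first.
- by apply: measurableT_comp => //; apply: measurable_funD => //; exact: measurable_funM.
- by rewrite mulr_ge0// ?powR_ge0// ltW.
apply: eq_integral => u _; rewrite /f addr0 -EFinM; congr EFin.
rewrite !indicE; have [u0|u0] := ltP 0 u; last first.
  rewrite !memNset ?mul0r ?mulr0//= in_itv/= andbT; apply/negP; rewrite -leNgt//.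
  by rewrite pmulr_rle0.
rewrite !mem_set/= ?in_itv/= ?andbT// ?mulr_gt0// !mul1r powRM ?ltW//.
rewrite powRD; last by rewrite (gt_eqF w0) implybT.
rewrite powRN powR_inv1 ?ltW// powRN; field.
by rewrite !gt_eqF// ?powR_gt0.
Qed.

(* Write [w `^ (rho - 1)] as a Laplace transform and exchange the integrals. *)
Lemma gamma_laplace (rho x : R) : 0 < x ->
  (\int[mu]_(y in `]1%R, +oo[) (expR (- (x * y)) / (y * (y - 1) `^ rho))%:E =
   eupper_gamma rho x * eupper_gamma (1 - rho) 0)%E.
Proof.
move=> x0.
have G0 : (0 <= eupper_gamma (1 - rho) 0)%E.
  by apply: integral_ge0 => w _; rewrite lee_fin mulr_ge0 ?expR_ge0 ?powR_ge0.
set G := eupper_gamma (1 - rho) 0 in G0 *.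
(* Indicators extend the double integral to the plane. Integrating over [u] first yields the product
   of Gamma integrals; integrating over [w] first yields the integral over [y = u + 1]. *)
pose K (z : R * R) : R := \1_(`]x, +oo[%classic : set R) z.1 *
  (expR (- z.1) * (\1_(`]0%R, +oo[%classic : set R) z.2 *
    (expR (- (z.1 * z.2)) * z.2 `^ (- rho)))).
have K0 z : (0 <= (K z)%:E)%E.
  by rewrite lee_fin !mulr_ge0 ?expR_ge0 ?powR_ge0.
have mI (c : R) : measurable_fun setT (\1_(`]c, +oo[%classic : set R) : R -> R).
  exact: measurable_indic.
have mN : measurable_fun setT (fun w : R => expR (- w)).
  by apply: measurableT_comp => //; exact: measurable_oppr.
have m1 : measurable_fun setT
    (fun z : measurableTypeR R * measurableTypeR R => z.1 : R).
  exact: measurable_fst.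
have m2 : measurable_fun setT
    (fun z : measurableTypeR R * measurableTypeR R => z.2 : R).
  exact: measurable_snd.
have mK : measurable_fun setT
    (fun z : measurableTypeR R * measurableTypeR R => (K z)%:E).
  apply/measurable_EFinP; apply: measurable_funM.
    exact: (measurableT_comp (mI x) measurable_fst).
  apply: measurable_funM; first exact: (measurableT_comp mN measurable_fst).
  apply: measurable_funM; first exact: (measurableT_comp (mI 0) measurable_snd).
  apply: measurable_funM.
    exact: (measurableT_comp mN (measurable_funM m1 m2)).
  exact: (measurableT_comp (measurable_powR (- rho)) measurable_snd).
transitivity (\int[mu]_w \int[mu]_u (K (w, u))%:E)%E; last first.
  rewrite muleC /eupper_gamma [in RHS]integral_indicM -ge0_integralZl//; last 2 first.
  - apply/measurable_EFinP; apply: measurable_funM => //.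
    by apply: measurable_funM => //; exact: measurable_powR.
  - by move=> w _; rewrite lee_fin !mulr_ge0 ?expR_ge0 ?powR_ge0.
  apply: eq_integral => w _; rewrite /K /=.
  have [xw|wx] := ltP x w; last first.
    rewrite indicE memNset/=; last by rewrite in_itv/= andbT ltNge wx.
    under eq_integral do rewrite mul0r.
    by rewrite integral0 mul0r mule0.
  rewrite indicE mem_set/= ?in_itv/= ?xw//.
  under eq_integral do rewrite mul1r EFinM.
  rewrite ge0_integralZl_EFin ?expR_ge0//; last 2 first.
  - by move=> u _; rewrite lee_fin !mulr_ge0 ?expR_ge0 ?powR_ge0.
  - apply/measurable_EFinP; apply: measurable_funM => //.
    apply: measurable_funM; last exact: measurable_powR.
    by apply: (measurableT_comp mN (g := fun u => w * u)); exact: measurable_funM.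
  rewrite -integral_indicM integral_expRN_powR -/G; last exact: lt_trans xw.
  by rewrite mul1r muleA -EFinM muleC.
rewrite (@fubini_tonelli _ _ _ _ R mu mu (fun z => (K z)%:E) mK K0).
(* Negative powers replace the quotients to make measurability immediate; the indicator keeps
   [y > 1], where both forms agree. *)
pose g (y : R) := \1_(`]1%R, +oo[%classic : set R) y *
  (expR (- (x * y)) * (y `^ (-1) * (y - 1) `^ (- rho))).
rewrite integral_indicM [LHS](@eq_integral _ _ _ mu _ (fun y => (g y)%:E)); last first.
  move=> y _; rewrite /g !indicE; congr EFin.
  have [y1|y1] := ltP 1 y; last first.
    by rewrite memNset ?mul0r//= in_itv/= andbT ltNge y1.
  by rewrite powR_inv1 ?(le_trans _ (ltW y1))// powRN -invfM.
have mg : measurable_fun setT (fun y => (g y)%:E).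
  apply/measurable_EFinP; apply: measurable_funM => //.
  apply: measurable_funM.
    by apply: (measurableT_comp mN (g := fun u => x * u)); exact: measurable_funM.
  apply: measurable_funM; first exact: measurable_powR.
  have mB1 : measurable_fun setT (fun y : R => y - 1) by exact: measurable_funB.
  exact: (measurableT_comp (measurable_powR (- rho)) mB1).
have g0 y : (0 <= (g y)%:E)%E by rewrite lee_fin !mulr_ge0 ?expR_ge0 ?powR_ge0.
rewrite (ge0_integral_affine 1 ltr01 mg g0) mul1e.
apply: eq_integral => u _; rewrite mul1r /K /g /= !indicE.
have [u0|u0] := ltP 0 u; last first.
  rewrite memNset/=; last by rewrite in_itv/= andbT -ltrBlDr subrr ltNge u0.
  rewrite mul0r (memNset (A := `]0%R, +oo[%classic)); last first.
    by rewrite /= in_itv/= andbT ltNge u0.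
  by under eq_integral do rewrite /= mul0r !mulr0; rewrite integral0.
rewrite !mem_set/= ?in_itv/= ?andbT ?u0//; last by rewrite -ltrBlDr subrr.
under eq_integral => w _.
  rewrite (_ : expR (- w) * _ = u `^ (- rho) * expR (- ((u + 1) * w))); last first.
    by rewrite mulrDl opprD expRD !mul1r (mulrC u w); ring.
  rewrite mulrCA EFinM.
  over.
rewrite ge0_integralZl_EFin ?powR_ge0//; last first.
  apply/measurable_EFinP; apply: measurable_funM => //.
  by apply: (measurableT_comp mN (g := fun w => (u + 1) * w)); exact: measurable_funM.
have u1 : 0 < u + 1 by rewrite addr_gt0.
rewrite -integral_indicM integral_expRN_tail// -EFinM; congr EFin.
by rewrite addrK powR_inv1 ?ltW// mul1r (mulrC x); ring.
Qed.

End gamma_laplace.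

(** * Laplace transform of the mixing variable *)

Section mixing_laplace.
Context {R : realType} {d} {T : measurableType d} {P : probability T R}.
Local Notation mu := (@lebesgue_measure R).

Lemma eupper_gamma_ge0 (rho x : R) : (0 <= eupper_gamma rho x)%E.
Proof.
by apply: integral_ge0 => w _; rewrite lee_fin mulr_ge0 ?expR_ge0 ?powR_ge0.
Qed.

Lemma upper_gamma_ge0 (rho x : R) : 0 <= upper_gamma rho x.
Proof. by rewrite upper_gammaE fine_ge0// eupper_gamma_ge0. Qed.

(** Since [fine] sends infinities to 0, a nonzero real value certifies a finite integral. *)
Lemma upper_gammaK (rho x : R) : upper_gamma rho x != 0 ->
  eupper_gamma rho x = (upper_gamma rho x)%:E.
Proof. by rewrite upper_gammaE; case: eupper_gamma => //=; rewrite eqxx. Qed.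

Lemma eupper_gamma_le (rho x y : R) : x <= y ->
  (eupper_gamma rho y <= eupper_gamma rho x)%E.
Proof.
move=> xy; apply: ge0_subset_integral => //.
- apply/measurable_EFinP/measurable_funTS; apply: measurable_funM.
    by apply: measurableT_comp => //; exact: measurable_oppr.
  exact: measurable_powR.
- by move=> w _; rewrite lee_fin mulr_ge0 ?expR_ge0 ?powR_ge0.
- by move=> w /=; rewrite !in_itv/= !andbT; exact: le_lt_trans.
Qed.

Lemma upper_gamma1 (x : R) : upper_gamma 1 x = expR (- x).
Proof.
rewrite upper_gammaE /eupper_gamma subrr.
under eq_integral do rewrite powRr0 mulr1 -[X in - X]mul1r.
by rewrite integral_expRN_tail//= mul1r divr1.
Qed.

Lemma measurable_mixing_density (rho theta : R) :
  measurable_fun setT (mixing_density rho theta).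
Proof.
pose c := (upper_gamma rho theta * upper_gamma (1 - rho) 0)^-1.
rewrite (_ : mixing_density rho theta = (fun y =>
  c * (expR (- theta * y) * (y `^ (-1) * (y - 1) `^ (- rho))) *
  \1_[set z : R | 1 < z] y)).
  apply: measurable_funM.
    apply: measurable_funM => //; apply: measurable_funM.
      exact: measurable_expRM.
    apply: measurable_funM; first exact: measurable_powR.
    have mB1 : measurable_fun setT (fun y : R => y - 1) by exact: measurable_funB.
    exact: (measurableT_comp (measurable_powR (- rho)) mB1).
  rewrite (_ : [set z : R | 1 < z] = `]1, +oo[%classic); last first.
    by apply/seteqP; split => z /=; rewrite in_itv/= andbT.
  exact: measurable_indic.
apply/funext => y; rewrite /mixing_density -/c indicE.
case: (boolP (y \in _)); last by rewrite !mulr0.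
rewrite inE /= => y1; rewrite !mulr1; congr (_ * (_ * _)).
by rewrite powR_inv1 ?(le_trans _ (ltW y1))// powRN -invfM.
Qed.

(** For [rho = 1] both sides are [expR (- a)]. For [rho < 1] the exponential shifts [theta] to
    [theta + a] in the density, and [gamma_laplace] evaluates the result. The square of
    [Num.sqrt (Y w)] is what the Gaussian characteristic function at frequency [Num.sqrt (Y w)]
    produces. *)
Lemma mixing_laplace (rho theta a : R) (Y : {RV P >-> R}) :
  rho <= 1 -> 0 < theta -> 0 <= a -> mixing_rv rho theta Y ->
  \int[P]_w expR (- (a * Num.sqrt (Y w) ^+ 2)) =
  upper_gamma rho (theta + a) / upper_gamma rho theta.
Proof.
move=> rho1 theta0 a0 [Ylt Y1].
have msq : measurable_fun setT (fun y : R => expR (- (a * Num.sqrt y ^+ 2))).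
  apply: measurableT_comp => //; apply: measurableT_comp => //.
  apply: measurable_funM => //; apply: measurable_funX.
  by apply: continuous_measurable_fun; exact: sqrt_continuous.
have [rlt|rge] := ltP rho 1; last first.
  have {rge rho1} r1 : rho = 1 by apply/eqP; rewrite eq_le rho1 rge.
  rewrite r1 !upper_gamma1 opprD expRD mulrAC mulfV ?mul1r ?gt_eqF ?expR_gt0//.
  rewrite /Rintegral (ae_eq_integral (cst (expR (- a))%:E))//.
  - by rewrite probability_integral_cst.
  - apply/measurable_EFinP.
    exact: (measurableT_comp msq (measurable_funP Y)).
  - apply: filterS (Y1 r1) => w Yw _.
    by rewrite Yw sqrtr1 expr1n mulr1.
pose c := (upper_gamma rho theta * upper_gamma (1 - rho) 0)^-1.
have c0 : 0 <= c by rewrite invr_ge0 mulr_ge0// upper_gamma_ge0.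
have PY (b : R) : 0 <= b -> (\int[P]_w (expR (- (b * Num.sqrt (Y w) ^+ 2)))%:E =
    c%:E * (eupper_gamma rho (theta + b) * eupper_gamma (1 - rho) 0))%E.
  move=> b0.
  have mb : measurable_fun setT (fun y : R => (expR (- (b * Num.sqrt y ^+ 2)))%:E).
    apply/measurable_EFinP.
    apply: measurableT_comp => //; apply: measurableT_comp => //.
    apply: measurable_funM => //; apply: measurable_funX.
    by apply: continuous_measurable_fun; exact: sqrt_continuous.
  rewrite (ge0_integral_pdf (measurable_mixing_density rho theta) (Ylt rlt)
    (h := fun y => (expR (- (b * Num.sqrt y ^+ 2)))%:E))//.
  rewrite -gamma_laplace ?ltr_pwDl// [in RHS]integral_indicM.
  have s1E : [set z : R | 1 < z] = `]1, +oo[%classic.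
    by apply/seteqP; split => z /=; rewrite in_itv/= andbT.
  pose h (y : R) := \1_(`]1%R, +oo[%classic : set R) y *
    (expR (- ((theta + b) * y)) * (y `^ (-1) * (y - 1) `^ (- rho))).
  have hE (y : R) : \1_(`]1%R, +oo[%classic : set R) y *
      (expR (- ((theta + b) * y)) / (y * (y - 1) `^ rho)) = h y.
    rewrite /h indicE; case: (boolP (y \in _)); last by rewrite !mul0r.
    rewrite inE /= in_itv/= andbT => y1.
    by rewrite powR_inv1 ?(le_trans _ (ltW y1))// powRN -invfM.
  under [in RHS]eq_integral do rewrite hE.
  rewrite -ge0_integralZl_EFin//; last 2 first.
  - by move=> y _; rewrite lee_fin !mulr_ge0 ?expR_ge0 ?powR_ge0.
  - apply/measurable_EFinP; apply: measurable_funM.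
      exact: measurable_indic.
    apply: measurable_funM.
      by under eq_fun do rewrite -mulNr; exact: measurable_expRM.
    apply: measurable_funM; first exact: measurable_powR.
    have mB1 : measurable_fun setT (fun y : R => y - 1) by exact: measurable_funB.
    exact: (measurableT_comp (measurable_powR (- rho)) mB1).
  apply: eq_integral => y _; rewrite -!EFinM; congr EFin.
  rewrite -hE /mixing_density s1E -/c indicE.
  case: (boolP (y \in _)); last by rewrite mul0r !mulr0.
  rewrite inE /= in_itv/= andbT => y1; rewrite mulr1 mul1r sqr_sqrtr; last first.
    by rewrite (le_trans _ (ltW y1)).
  rewrite mulrCA; congr (_ * _); rewrite mulrA; congr (_ / _).
  by rewrite -expRD; congr expR; ring.
(* The case [b = 0] expresses total mass 1. Hence [c] is nonzero, so both Gamma values are nonzero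
   and therefore finite. *)
have P1 := PY 0 (lexx 0).
have {}P1 : (c%:E * (eupper_gamma rho theta * eupper_gamma (1 - rho) 0) = 1)%E.
  rewrite -[theta in LHS]addr0 -P1; under eq_integral do rewrite mul0r oppr0 expR0.
  by rewrite probability_integral_cst.
have cn0 : c != 0.
  by apply/eqP => c00; move: P1; rewrite c00 mul0e => /eqP; rewrite eq_sym onee_eq0.
have [g1 g2] : upper_gamma rho theta != 0 /\ upper_gamma (1 - rho) 0 != 0.
  by move: cn0; rewrite invr_eq0 mulf_eq0 negb_or => /andP.
have E1 := upper_gammaK g1; have E2 := upper_gammaK g2.
have E3 : eupper_gamma rho (theta + a) = (upper_gamma rho (theta + a))%:E.
  rewrite upper_gammaE fineK// ge0_fin_numE ?eupper_gamma_ge0//.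
  apply: (le_lt_trans (eupper_gamma_le rho (x := theta) _)); first by rewrite lerDl.
  by rewrite E1 ltry.
rewrite /Rintegral PY// E3 E2 /= /c; field.
by rewrite g1 g2.
Qed.

End mixing_laplace.

(** * Finite-dimensional laws *)

Section independence.
Context {R : realType} {d} {T : measurableType d}.
Variables (P : probability T R) (Y L : {mfun T >-> R}).
Hypothesis indep : forall A B : set R, measurable A -> measurable B ->
  P (Y @^-1` A `&` L @^-1` B) = (P (Y @^-1` A) * P (L @^-1` B))%E.

Let Z (w : T) : R * R := (Y w, L w).

Let mZ : measurable_fun setT Z.
Proof.
apply: measurable_fun_pair; [exact: (measurable_funP Y)|exact: (measurable_funP L)].
Qed.

HB.instance Definition _ := isMeasurableFun.Build _ _ _ _ Z mZ.

(** The joint law of [Y] and [L] agrees with the product of the marginals on rectangles, hence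
    everywhere; Fubini's theorem then applies to the bounded [F]. *)
Lemma independent_Rintegral (F : R * R -> R) (M : R) :
  measurable_fun setT F -> (forall z, `|F z| <= M) ->
  \int[P]_w F (Y w, L w) = \int[P]_w \int[P]_v F (Y w, L v).
Proof.
move=> mF FM.
pose mY := distribution P Y; pose mL := distribution P L.
have ZE A : measurable A -> (mY \x mL)%E A = distribution P Z A.
  by apply: product_measure_unique => A1 A2 mA1 mA2; rewrite -indep.
have mFy y : measurable_fun setT (fun l => F (y, l)) by exact: measurable_fun_pair2.
have mFyL y : measurable_fun setT (fun v => F (y, L v)).
  exact: (measurableT_comp (mFy y) (measurable_funP L)).
pose g y := \int[P]_v F (y, L v).
have IFL y : P.-integrable setT (fun v => (F (y, L v))%:E).
  exact: (bounded_integrable P (mFyL y) (fun=> FM _)).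
have gE y : (\int[mL]_l (F (y, l))%:E)%E = (g y)%:E.
  have mEF : measurable_fun setT (fun l => (F (y, l))%:E) by exact/measurable_EFinP.
  rewrite (integral_distribution mEF (IFL y)).
  by rewrite /g /Rintegral fineK//; exact: integrable_fin_num.
have IF : (mY \x mL)%E.-integrable setT (EFin \o F).
  apply: measurable_bounded_integrable => //.
    rewrite [ltLHS]ZE//; exact: le_lt_trans (probability_le1 _ _) (ltry 1).
  by exists M; split; [exact: num_real|move=> z Mz x _ /=; exact: le_trans (ltW Mz)].
have mg : measurable_fun setT g.
  apply/measurable_EFinP; have := measurable_fubini_F IF.
  by congr (measurable_fun _ _); apply/funext => y; rewrite /fubini_F /= gE.
have gM y : `|g y| <= M.
  rewrite /g (le_trans (le_normr_Rintegral _ (IFL y)))//.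
  have -> : M = \int[P]_v M.
    by rewrite /Rintegral probability_integral_cst.
  apply: le_Rintegral => //.
  - exact: (integrable_norm (IFL y)).
  - exact: finite_measure_integrable_cst.
have IZ : P.-integrable setT (EFin \o (F \o Z)).
  by apply: (bounded_integrable P _ (fun=> FM _)); exact: measurableT_comp.
rewrite -[LHS](Rintegral_distribution (X := Z) mF IZ).
have Ig : P.-integrable setT (EFin \o (g \o Y)).
  apply: (bounded_integrable P _ (fun=> gM _)).
  exact: (measurableT_comp mg (measurable_funP Y)).
rewrite -[RHS](Rintegral_distribution (X := Y) mg Ig) /Rintegral; congr fine.
rewrite (eq_measure_integral (mY \x mL)%E); last by move=> A mA _; rewrite /= -ZE.
rewrite -(integral12_prod_meas1 IF); apply: eq_integral => y _.
by rewrite /fubini_F /= gE.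
Qed.

End independence.

(** Serves to put arbitrary times in increasing order. The permutation is read off the sorted list
    of indices. *)
Lemma sort_perm {R : realType} (n : nat) (f : 'I_n -> R) :
  exists s : {perm 'I_n}, forall j k : 'I_n, (j <= k)%N -> f (s j) <= f (s k).
Proof.
pose leT := relpre f <=%R.
have tr : transitive leT by move=> a b c; exact: le_trans.
have rf : reflexive leT by move=> a; exact: lexx.
have tot : total leT by move=> a b; exact: le_total.
have : perm_eq (sort leT (ord_tuple n)) (ord_tuple n) by rewrite perm_sort.
move=> /tuple_permP[s sE]; exists s => j k jk.
have sz : size (sort leT (ord_tuple n)) = n by rewrite size_sort size_tuple.
have nthE (i : 'I_n) : nth i (sort leT (ord_tuple n)) i = s i.
  by rewrite sE -[nth _ _ _]/(nth i (val [tuple tnth (ord_tuple n) (s i0) | i0 < n]) i)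
     -tnth_nth tnth_mktuple tnth_ord_tuple.
have := sorted_leq_nth tr rf j (sort_sorted tot (ord_tuple n)).
move=> /(_ j k); rewrite !inE !sz !ltn_ord => /(_ isT isT jk).
by rewrite nthE (set_nth_default k) ?sz// nthE.
Qed.

Section Rintegral_sum.
Context {R : realType} {d} {T : measurableType d} (P : probability T R).

Lemma Rintegral_sum (n : nat) (f : 'I_n -> T -> R) :
  (forall i, P.-integrable setT (EFin \o f i)) ->
  \int[P]_w (\sum_(i < n) f i w) = \sum_(i < n) \int[P]_w f i w.
Proof.
move=> If; rewrite /Rintegral; under eq_integral do rewrite -sumEFin.
rewrite (integral_sum measurableT If) -EFin_sum_fine// => i _.
by apply: integrable_fin_num => //; exact: If.
Qed.

End Rintegral_sum.

(** * Characteristic function of the tempered process *)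

Section tempered_characteristic.
Context {R : realType} {d} {T : measurableType d} {P : probability T R}.
Variables (alpha rho theta : R) (X : process P).
Hypothesis hX : tempered_ggbm alpha rho theta X.

(** For a fractional Brownian motion with Hurst parameter [alpha / 2] this is the variance of the
    linear combination with coefficients [xi]. *)
Definition fdd_cov (n : nat) (t : 'I_n -> {nonneg R}) (xi : 'I_n -> R) : R :=
  \sum_(j < n) \sum_(k < n) xi j * xi k * gamma_cov alpha (t j)%:num (t k)%:num.

(* The characteristic function is prescribed for ordered times only. *)
Lemma tempered_ggbm_unordered (n : nat) (t : 'I_n -> {nonneg R}) (xi : 'I_n -> R) :
  expect_expi P (fun w => \sum_(k < n) xi k * X (t k) w) =
  (upper_gamma rho (theta + 2^-1 * fdd_cov t xi) / upper_gamma rho theta)%:C%C.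
Proof.
have [s sE] := sort_perm (fun k => (t k)%:num).
have := hX (t := fun k => t (s k)) (fun k => xi (s k)) sE.
have -> : \sum_(j < n) \sum_(k < n) xi (s j) * xi (s k) *
    gamma_cov alpha (t (s j))%:num (t (s k))%:num = fdd_cov t xi.
  rewrite /fdd_cov [RHS](reindex_inj (@perm_inj _ s)); apply: eq_bigr => j _.
  by rewrite [RHS](reindex_inj (@perm_inj _ s)).
move=> <-; congr (expect_expi P _); apply/funext => w.
by rewrite [LHS](reindex_inj (@perm_inj _ s)).
Qed.

Lemma measurable_process_sum (n : nat) (t : 'I_n -> {nonneg R}) (xi : 'I_n -> R) :
  measurable_fun setT (fun w => \sum_(k < n) xi k * X (t k) w).
Proof.
by apply: measurable_sum => k; exact: measurable_funM.
Qed.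

End tempered_characteristic.

(** Passes from the characteristic function, given by its cosine and sine integrals, to plane waves
    with a phase. *)
Lemma Rintegral_cosD {R : realType} {d} {T : measurableType d}
    (P : probability T R) (S : T -> R) (c : R) : measurable_fun setT S ->
  \int[P]_w cos (S w + c) =
  cos c * \int[P]_w cos (S w) - sin c * \int[P]_w sin (S w).
Proof.
move=> mS.
have mc : measurable_fun setT (fun w => cos (S w)).
  apply: (measurableT_comp _ mS); apply: continuous_measurable_fun.
  exact: continuous_cos.
have ms : measurable_fun setT (fun w => sin (S w)).
  apply: (measurableT_comp _ mS); apply: continuous_measurable_fun.
  exact: continuous_sin.
have Ic : P.-integrable setT (fun w => (cos (S w))%:E).
  exact: (bounded_integrable P mc (fun=> cos_max _)).
have Is : P.-integrable setT (fun w => (sin (S w))%:E).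
  exact: (bounded_integrable P ms (fun=> sin_max _)).
under eq_Rintegral do rewrite cosD (mulrC (cos _)) (mulrC (sin _)).
rewrite RintegralB//; last 2 first.
- exact: (integrableZl measurableT (cos c) Ic).
- exact: (integrableZl measurableT (sin c) Is).
by rewrite !RintegralZl.
Qed.

(** * Linear combinations of fractional Brownian motion *)

Section brownian_combinations.
Context {R : realType} {d} {T : measurableType d} {P : probability T R}.
Variables (H : R) (B : process P).
Hypothesis hB : fractional_brownian_motion H B.

Let gaussian1 t : gaussian_rv P (B t).
Proof.
have [hG _ _] := hB; have := hG 1%N (fun=> t) (fun=> 1).
by congr (gaussian_rv P _); apply/funext => w; rewrite big_ord1 mul1r.
Qed.

Let integrable_sqr t : P.-integrable setT (fun w => (B t w ^+ 2)%:E).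
Proof. exact: gaussian_rv_integrable_sqr (gaussian1 t). Qed.

(** Gaussian marginals are square integrable, and [|a b| <= a ^ 2 + b ^ 2]. This lets the double sum
    be exchanged with the expectation in the variance. *)
Let integrable_mul s t : P.-integrable setT (fun w => (B s w * B t w)%:E).
Proof.
apply: (@le_integrable _ _ _ P setT measurableT _
  (fun w => (B s w ^+ 2)%:E + (B t w ^+ 2)%:E)%E).
- apply/measurable_EFinP/measurable_funM; exact: measurable_funP.
- move=> w _; rewrite -EFinD !abse_EFin lee_fin [leRHS]ger0_norm; last first.
    by rewrite addr_ge0 ?sqr_ge0.
  rewrite normrM -(real_normK (num_real (B s w))) -(real_normK (num_real (B t w))).
  have := sqr_ge0 (`|B s w| - `|B t w|); have := normr_ge0 (B s w).
  have := normr_ge0 (B t w); nra.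
- by apply: integrableD.
Qed.

Let integrable1 t : P.-integrable setT (fun w => (B t w)%:E).
Proof.
apply: (@le_integrable _ _ _ P setT measurableT _
  (fun w => 1%:E + (B t w ^+ 2)%:E)%E).
- by apply/measurable_EFinP; exact: measurable_funP.
- move=> w _; rewrite -EFinD !abse_EFin lee_fin [leRHS]ger0_norm; last first.
    by rewrite addr_ge0 ?sqr_ge0.
  rewrite -(real_normK (num_real (B t w))).
  have := normr_ge0 (B t w); nra.
- by apply: integrableD => //; exact: finite_measure_integrable_cst.
Qed.

Lemma fbm_sum_mean (n : nat) (t : 'I_n -> {nonneg R}) (xi : 'I_n -> R) :
  \int[P]_w (\sum_(k < n) xi k * B (t k) w) = 0.
Proof.
have [_ hm _] := hB.
rewrite (Rintegral_sum (f := fun k w => xi k * B (t k) w)); last first.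
  by move=> k; exact: (integrableZl measurableT (xi k) (integrable1 (t k))).
rewrite big1// => k _; rewrite RintegralZl//; last exact: integrable1.
by have := hm (t k); rewrite expectation_def /Rintegral => ->; rewrite mulr0.
Qed.

Lemma fbm_sum_variance (n : nat) (t : 'I_n -> {nonneg R}) (xi : 'I_n -> R) :
  \int[P]_w (\sum_(k < n) xi k * B (t k) w) ^+ 2 = fdd_cov (2 * H) t xi.
Proof.
have [_ _ hc] := hB.
under eq_Rintegral => w _.
  rewrite expr2 mulr_suml; under eq_bigr do rewrite mulr_sumr; over.
have Ijk j k : P.-integrable setT
    (fun w => (xi j * B (t j) w * (xi k * B (t k) w))%:E).
  have -> : (fun w => (xi j * B (t j) w * (xi k * B (t k) w))%:E) =
      (fun w => (xi j * xi k)%:E * (B (t j) w * B (t k) w)%:E)%E.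
    by apply/funext => w; rewrite -EFinM mulrACA.
  exact: integrableZl.
rewrite (Rintegral_sum (f := fun j w =>
    \sum_(k < n) xi j * B (t j) w * (xi k * B (t k) w))); last first.
  move=> j; rewrite (_ : _ \o _ = (fun w =>
      \sum_(k < n) (xi j * B (t j) w * (xi k * B (t k) w))%:E)%E).
    by apply: integrable_sum => // k _; exact: Ijk.
  by apply/funext => w /=; rewrite sumEFin.
apply: eq_bigr => j _.
rewrite (Rintegral_sum (f := fun k w => xi j * B (t j) w * (xi k * B (t k) w)));
  last by move=> k; exact: Ijk.
apply: eq_bigr => k _; under eq_Rintegral do rewrite mulrACA.
rewrite RintegralZl//; last exact: integrable_mul.
congr (_ * _).
transitivity (fine ('E_P[B (t k) \* B (t j)])%E); last by rewrite hc.
by rewrite expectation_def; apply: eq_Rintegral => w _; rewrite mulrC.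
Qed.

End brownian_combinations.

(** * Characteristic function of the scaled process and comparison of the laws *)

Lemma sigma_process_sum {R : realType} {d} {T : measurableType d}
    {P : probability T R} (B : process P) (n : nat) (t : 'I_n -> {nonneg R})
    (xi : 'I_n -> R) (A : set R) : measurable A ->
  sigma_process B ((fun w => \sum_(k < n) xi k * B (t k) w) @^-1` A).
Proof.
move=> mA.
pose G := \bigcup_(t : {nonneg R}) preimage_set_system setT (B t) measurable.
(* When [T] carries the sigma-algebra generated by the process, every [B s] is measurable by
   construction, and sums inherit this. *)
have mB s : measurable_fun setT (B s : g_sigma_algebraType G -> R).
  move=> _ A' mA'; apply: sub_sigma_algebra; exists s => //.
  by exists A' => //.
have mS : measurable_fun setT
    (fun w : g_sigma_algebraType G => \sum_(k < n) xi k * B (t k) w).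
  by apply: measurable_sum => k; apply: measurable_funM => //; exact: mB.
by have := mS measurableT A mA; rewrite setTI.
Qed.

(** Independence allows [Y] to be frozen: the inner expectation is a centered Gaussian
    characteristic function at frequency [Num.sqrt (Y w)], the outer one the Laplace transform of
    [Y] at half the variance. *)
Lemma sqrt_scaled_fbm_cos {R : realType} {d} {T : measurableType d}
    {P : probability T R} (H rho theta : R) (B : process P) (Y : {RV P >-> R})
    (n : nat) (t : 'I_n -> {nonneg R}) (xi : 'I_n -> R) (c : R) :
  rho <= 1 -> 0 < theta -> fractional_brownian_motion H B ->
  mixing_rv rho theta Y -> independent_rv_process Y B ->
  \int[P]_w cos (\sum_(k < n) xi k * sqrt_scaled Y B (t k) w + c) =
  cos c * (upper_gamma rho (theta + 2^-1 * fdd_cov (2 * H) t xi) /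
           upper_gamma rho theta).
Proof.
move=> rho1 theta0 hB hY hYB.
pose S w := \sum_(k < n) xi k * B (t k) w.
have mS : measurable_fun setT S by exact: measurable_process_sum.
pose L : {mfun T >-> R} := HB.pack S (isMeasurableFun.Build _ _ _ _ S mS).
have indep (A1 A2 : set R) : measurable A1 -> measurable A2 ->
    P (Y @^-1` A1 `&` L @^-1` A2) = (P (Y @^-1` A1) * P (L @^-1` A2))%E.
  move=> m1 m2; apply: hYB; last exact: sigma_process_sum.
  by exists A1 => //; rewrite setTI.
have gL : gaussian_rv P L by have [hG _ _] := hB; exact: hG.
pose F (z : R * R) := cos (Num.sqrt z.1 * z.2 + c).
have mF : measurable_fun setT F.
  apply: (measurableT_comp (f := @cos R)).
    by apply: continuous_measurable_fun; exact: continuous_cos.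
  apply: measurable_funD => //; apply: measurable_funM => //.
  apply: (measurableT_comp (f := @Num.sqrt R)) => //.
  by apply: continuous_measurable_fun; exact: sqrt_continuous.
transitivity (\int[P]_w F (Y w, L w)).
  apply: eq_Rintegral => w _; rewrite /F /= /S mulr_sumr; congr (cos (_ + c)).
  by apply: eq_bigr => k _; rewrite /sqrt_scaled_fun mulrCA.
rewrite (independent_Rintegral indep (M := 1) mF)//; last first.
  by move=> z; exact: cos_max.
have inner w : \int[P]_v F (Y w, L v) =
    cos c * expR (- (2^-1 * fdd_cov (2 * H) t xi * Num.sqrt (Y w) ^+ 2)).
  rewrite [LHS](gaussian_rv_cos (Num.sqrt (Y w)) c gL (fbm_sum_mean hB t xi)).
  by rewrite (fbm_sum_variance hB t xi); congr (_ * expR (- _)); ring.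
under eq_Rintegral do rewrite inner.
(* The double sum is the integral of a square, which gives the sign that [mixing_laplace] asks
   for. *)
have V0 : 0 <= 2^-1 * fdd_cov (2 * H) t xi.
  rewrite mulr_ge0// -(fbm_sum_variance hB) Rintegral_ge0// => w _.
  exact: sqr_ge0.
have mE : measurable_fun setT
    (fun w => expR (- (2^-1 * fdd_cov (2 * H) t xi * Num.sqrt (Y w) ^+ 2))).
  apply: measurableT_comp => //; apply: measurableT_comp => //.
  apply: measurable_funM => //; apply: measurable_funX.
  apply: (measurableT_comp (f := @Num.sqrt R)) => //.
  by apply: continuous_measurable_fun; exact: sqrt_continuous.
rewrite RintegralZl//; last first.
  apply: (bounded_integrable P (M := 1) mE) => w.
  by rewrite ger0_norm ?expR_ge0// expR_le1 oppr_le0 mulr_ge0// sqr_ge0.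
by rewrite (mixing_laplace rho1 theta0 V0 hY).
Qed.

Unset Implicit Arguments.

Theorem theorem4p1 (R : realType) (alpha rho theta : R)
    (halpha : 0 < alpha < 2) (hrho : 0 < rho <= 1) (htheta : 0 < theta)
    (d1 : measure_display) (T1 : measurableType d1) (P1 : probability T1 R)
    (Btemp : process P1) (hBtemp : tempered_ggbm alpha rho theta Btemp)
    (d2 : measure_display) (T2 : measurableType d2) (P2 : probability T2 R)
    (B : process P2) (hB : fractional_brownian_motion (alpha / 2) B)
    (Y : {RV P2 >-> R}) (hY : mixing_rv rho theta Y)
    (hYB : independent_rv_process Y B) :
  fdd_eq Btemp (sqrt_scaled Y B).
Proof.
move=> n t A mA; have /andP[_ rho1] := hrho.
apply: plane_wave_unique => // f wf.
have mf := plane_wave_measurable wf; have [M fM] := plane_wave_bounded wf.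
(* Integrals against the laws on tuples become expectations, on either probability space. *)
have toP d (T : measurableType d) (P : probability T R) (X : process P) :
    (\int[distribution P (fdd X t)]_x (f x)%:E = (\int[P]_w f (fdd X t w))%:E)%E.
  have mEf : measurable_fun setT (fun x => (f x)%:E) by exact/measurable_EFinP.
  have If : P.-integrable setT (EFin \o (f \o fdd X t)).
    apply: (bounded_integrable P _ (fun=> fM _)).
    exact: (measurableT_comp mf (measurable_fdd X t)).
  rewrite (integral_distribution mEf If) /Rintegral fineK//.
  exact: integrable_fin_num.
rewrite !toP; congr EFin; have [xi [c ->]] := wf.
under eq_Rintegral do under eq_bigr do rewrite tnth_mktuple.
under [RHS]eq_Rintegral do under eq_bigr do rewrite tnth_mktuple.
rewrite (sqrt_scaled_fbm_cos t xi c rho1 htheta hB hY hYB).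
rewrite Rintegral_cosD; last exact: measurable_process_sum.
(* Compare real and imaginary parts: the prescribed value is real, so the sine integral is 0 and the
   [sin c] term drops out. *)
have [-> ->] := tempered_ggbm_unordered hBtemp t xi.
have -> : 2 * (alpha / 2) = alpha by rewrite mulrC divfK.
by rewrite mulr0 subr0.
Qed.
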